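(* Let $E$ be a separable Banach space without copies of $\ell^1(\mathbb{N})$ and let $f:E^\ast \longrightarrow \mathbb{R}\cup\{+\infty\}$ be a norm lower semicontinuous, convex and proper map such that for all $x\in E$, the function $x-f$ attains its supremum on $E^\ast$. Then the map $f$ is weak$^\ast$-lower semicontinuous and for every $\mu\in \mathbb{R}$ the sublevel set $f^{-1}((-\infty,\mu])$ is weak$^\ast$-compact.
   Context: Banach spaces are real. For $x\in E$, $x-f$ denotes the function $x^\ast\mapsto \langle x,x^\ast\rangle - f(x^\ast)$ on $E^\ast$. ''Without copies of $\ell^1(\mathbb{N})$'' means that no closed subspace of $E$ is isomorphic to $\ell^1(\mathbb{N})$. The weak$^\ast$ topology is $\sigma(E^\ast,E)$. Proper means not identically $+\infty$. *)

(* Defs.v *)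
From HB Require Import structures.
From mathcomp Require Import all_boot all_order all_algebra.
From mathcomp Require Import all_classical all_reals all_analysis.

Set Implicit Arguments.
Unset Strict Implicit.
Unset Printing Implicit Defensive.

Import Order.TTheory GRing.Theory Num.Theory.
Import numFieldNormedType.Exports.

Local Open Scope classical_set_scope.
Local Open Scope ring_scope.

Section Dual.
Context {R : realType} (E : normedModType R).

Definition dual_pred : {pred (E -> R)} :=
  [pred phi : E -> R | `[< linear phi /\ continuous phi >]].

Record dual := Dual { dual_fun :> E -> R ; _ : dual_fun \in dual_pred }.

HB.instance Definition _ := [isSub for dual_fun].
HB.instance Definition _ := [Choice of dual by <:].

Lemma dual_submod_closed : submod_closed dual_pred.
Proof.
split.
  apply/asboolP; split; last exact: cst_continuous.
  by move=> a x y /=; rewrite scaler0 addr0.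
move=> a u v /asboolP[lu cu] /asboolP[lv cv].
apply/asboolP; split.
  by move=> b x y; rewrite !fctE lu lv !scalerDr !scalerA [a * b]mulrC addrACA.
by move=> x; apply: continuousD; [apply: continuousZr; exact: cu|exact: cv].
Qed.

HB.instance Definition _ :=
  GRing.isSubmodClosed.Build R (E -> R) dual_pred dual_submod_closed.
HB.instance Definition _ := [SubChoice_isSubLmodule of dual by <:].

Lemma dual_linear (phi : dual) : linear phi.
Proof. by case: phi => phi /= /asboolP[]. Qed.

Lemma dual_continuous (phi : dual) : continuous phi.
Proof. by case: phi => phi /= /asboolP[]. Qed.

HB.instance Definition _ (phi : dual) :=
  GRing.isLinear.Build R E R _ phi (dual_linear phi).

Definition dual_norm (phi : dual) : R :=
  sup [set `|phi x| | x in [set x : E | `|x| <= 1]].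

Lemma dual_has_sup (phi : dual) :
  has_sup [set `|phi x| | x in [set x : E | `|x| <= 1]].
Proof.
split; first by exists `|phi 0|; exists 0 => //=; rewrite normr0.
have /linear_bounded_continuous/bounded_funP/(_ 1)[M phiM] :=
  dual_continuous (phi := phi).
by exists M => _ [x /= x1 <-]; exact: phiM.
Qed.

Lemma dual_norm_ub (phi : dual) (x : E) : `|x| <= 1 -> `|phi x| <= dual_norm phi.
Proof.
by move=> x1; apply: sup_upper_bound; [exact: dual_has_sup|exists x].
Qed.

Lemma dual_norm_le (phi : dual) (M : R) :
  (forall x, `|x| <= 1 -> `|phi x| <= M) -> dual_norm phi <= M.
Proof.
move=> phiM; apply: ge_sup; first by case: (dual_has_sup phi).
by move=> _ [x /= x1 <-]; exact: phiM.
Qed.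

Lemma dual_normD (phi psi : dual) :
  dual_norm (phi + psi) <= dual_norm phi + dual_norm psi.
Proof.
apply: dual_norm_le => x x1; rewrite (le_trans (ler_normD _ _))//.
by rewrite lerD// dual_norm_ub.
Qed.

Lemma dual_normZ_le (a : R) (phi : dual) :
  dual_norm (a *: phi) <= `|a| * dual_norm phi.
Proof.
by apply: dual_norm_le => x x1; rewrite normrM ler_wpM2l// dual_norm_ub.
Qed.

Lemma dual_normZ (a : R) (phi : dual) :
  dual_norm (a *: phi) = `|a| * dual_norm phi.
Proof.
apply/eqP; rewrite eq_le dual_normZ_le/=.
have [->|a0] := eqVneq a 0.
  rewrite normr0 mul0r; apply: le_trans (dual_norm_ub (x := 0) _ _) => //.
  by rewrite normr0.
rewrite -ler_pdivlMl ?normr_gt0// -normfV.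
by rewrite -{1}[phi](scalerK a0) dual_normZ_le.
Qed.

Lemma dual_norm_eq0 (phi : dual) : dual_norm phi = 0 -> phi = 0.
Proof.
move=> phi0; apply: val_inj; apply/funext => x /=.
have [->|x0] := eqVneq x 0; first by rewrite linear0.
have := @dual_norm_ub phi (`|x|^-1 *: x).
rewrite normrZ normfV normr_id mulVf ?normr_eq0// phi0 linearZ/= => /(_ (lexx _)).
rewrite normr_le0 /GRing.scale/= mulf_eq0 invr_eq0 normr_eq0 (negPf x0)/=.
by move/eqP.
Qed.

HB.instance Definition _ := Lmodule_isNormed.Build R dual
  dual_normD dual_normZ dual_norm_eq0.

(* sigma(E^*, E), the coarsest topology making every evaluation
   phi |-> phi x continuous. *)
Definition weak_star : Type :=
  sup_topology (fun x : E =>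
    Topological.on (initial_topology (fun phi : dual => phi x))).

HB.instance Definition _ := Topological.on weak_star.

End Dual.

Section Ell1.
Context (R : realType).

Definition ell1_pred : {pred (nat -> R)} :=
  [pred a : nat -> R | `[< cvgn [normed series a] >]].

Record ell1 := Ell1 { ell1_seq :> nat -> R ; _ : ell1_seq \in ell1_pred }.

HB.instance Definition _ := [isSub for ell1_seq].
HB.instance Definition _ := [Choice of ell1 by <:].

Lemma ell1_submod_closed : submod_closed ell1_pred.
Proof.
split.
  apply/asboolP; rewrite (_ : [normed series _] = cst 0); first exact: is_cvg_cst.
  by apply/funext => n; rewrite /= /series/= big1// => i _; rewrite normr0.
move=> k a b /asboolP ca /asboolP cb; apply/asboolP.
apply: (@series_le_cvg _ _
  (`|k| *: (fun n => `|a n|) + (fun n => `|b n|) : R ^nat)) => [n|n|n|].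
- exact: normr_ge0.
- by rewrite !fctE addr_ge0// mulr_ge0.
- by rewrite !fctE (le_trans (ler_normD _ _))// normrM.
- by apply: is_cvg_seriesD => //; exact: is_cvg_seriesZ.
Qed.

HB.instance Definition _ :=
  GRing.isSubmodClosed.Build R (nat -> R) ell1_pred ell1_submod_closed.
HB.instance Definition _ := [SubChoice_isSubLmodule of ell1 by <:].

Lemma ell1_cvg (a : ell1) : cvgn [normed series a].
Proof. by case: a => a /= /asboolP. Qed.

Definition ell1_norm (a : ell1) : R := limn [normed series a].

Lemma ell1_normD (a b : ell1) : ell1_norm (a + b) <= ell1_norm a + ell1_norm b.
Proof.
have ca := @ell1_cvg a; have cb := @ell1_cvg b.
rewrite -lim_seriesD//; apply: lim_series_le.
- exact: ell1_cvg.
- exact: is_cvg_seriesD.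
- by move=> n /=; rewrite !fctE ler_normD.
Qed.

Lemma ell1_normZ (k : R) (a : ell1) : ell1_norm (k *: a) = `|k| * ell1_norm a.
Proof.
rewrite /ell1_norm (_ : [normed series _] = series (`|k| *: (fun n => `|a n|))).
  by rewrite lim_seriesZ//; exact: ell1_cvg.
by congr series; apply/funext => n /=; rewrite normrM.
Qed.

Lemma ell1_norm_eq0 (a : ell1) : ell1_norm a = 0 -> a = 0.
Proof.
move=> a0; apply: val_inj; apply/funext => n /=.
apply/eqP; rewrite -normr_le0 -a0.
have nda : nondecreasing_seq [normed series a].
  by apply: nondecreasing_series => i _ _; exact: normr_ge0.
apply: le_trans (nondecreasing_cvgn_le nda (@ell1_cvg a) n.+1).
by rewrite /= /series/= big_nat_recr//= lerDr sumr_ge0.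
Qed.

HB.instance Definition _ := Lmodule_isNormed.Build R ell1
  ell1_normD ell1_normZ ell1_norm_eq0.

End Ell1.

Section Notions.
Context {R : realType}.

Definition separable (T : topologicalType) :=
  exists2 D : set T, countable D & dense D.

(* S is the inverse of T on F; its values outside F are irrelevant. *)
Definition isomorphic_onto (V W : normedModType R) (F : set W) :=
  exists (T : {linear V -> W}) (S : W -> V),
    [/\ continuous T, range T = F, cancel T S & {within F, continuous S}].

Definition contains_copy_of (V W : normedModType R) :=
  exists F : set W, [/\ closed F, submod_closed [in F] & isomorphic_onto V F].

Local Open Scope ereal_scope.

(* No case +oo + -oo arises below when f avoids -oo, and 0 * +oo = 0 in \bar R,
   so the cases t = 0 and t = 1 hold automatically. *)
Definition convex_efun (V : lmodType R) (f : V -> \bar R) :=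
  forall (x y : V) (t : R), (0 <= t <= 1)%R ->
    f (t *: x + (1 - t) *: y)%R <= t%:E * f x + (1 - t)%:E * f y.

Definition attains_sup (T : Type) (g : T -> \bar R) :=
  exists x, g x = ereal_sup (range g).

End Notions.

(* Main.v *)
Require Import Defs.
From HB Require Import structures.
From mathcomp Require Import all_boot all_order all_algebra.
From mathcomp Require Import all_classical all_reals all_analysis.
From mathcomp Require Import ring lra.

(** Let [g x] be the supremum of [phi x - f phi] over the functionals [phi];
it is a maximum by hypothesis, hence finite. Since [phi x <= g x + mu] and
[- phi x <= g (- x) + mu] on the sublevel set at [mu], that set is pointwise
bounded, hence norm bounded by the uniform boundedness principle. By the
Banach-Alaoglu theorem everything reduces to weak* lower semicontinuity: [f]
must be the supremum of the weak* continuous functions [phi |-> phi x - g x].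

Hahn-Banach in the dual ([affine_minorant]) presents [f] as the supremum of
its affine minorants [X + c] with [X] in the bidual. The heart of the matter
([predual_affine_minorant]) is that the value at [phi0] of such a minorant is
almost reached by minorants [phi |-> phi x - g x] with [x] in [E]. If it were
not, then [g >= e / 2 - c] for some [e > 0] on the convex set of all [x] in a
ball of [E] with [phi0 x] close to [X phi0], although [X phi - f phi <= - c]
for all [phi]. Simons' inequality ([simons]) says the following: for
decreasing closed convex subsets [C n] of that set there are a single [phi]
and points [z n] in [C n] with [phi (z n) - f phi >= e / 2 - c], up to a small
error. So the contradiction follows once the [C n] are such that, for every
[phi], all points [y] of [C n] satisfy [phi y <= X phi + e / 4] for [n] large.

Two facts provide the [C n]. The dual is covered by countably many weak*
compact sets [A] such that each [phi] lies in one of them on which [X] is at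
most [X phi] up to a small error ([countable_cover]). And if [X <= al] on a
weak* compact set, then any bounded convex set of which [X] is a weak* limit
contains a point [y] with [y <= al + d] on that set ([haydon_separation]);
hence the sets [A] can be treated one after the other.

These two facts are where the absence of [l^1] enters, through one
construction ([ell1_copy_of_tree]). Suppose that in a family of nonempty
bounded sets of functionals any finitely many sets can be cut simultaneously,
by one point [x] of a ball of [E], into a part where [phi x < a] and a part
where [phi x > b], both of which contain members of the family. Iterating
gives a sequence [x n] for which all patterns of the signs occur, and such a
sequence spans a copy of [l^1]. If [X] oscillates between [a] and [b] on every
open piece of a set, Goldstine's theorem provides the cuts, so that without
copies of [l^1] the oscillation of [X] can be exhausted by a countable
process. If [y <= al + d] fails for all [y], then a mean carried by the
compact set sees all points of the convex set above [al + d], whereas each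
functional of the compact set sees the points near [X] below [al + d]; this
conflict provides the cuts in the second case. *)

Set Implicit Arguments.
Unset Strict Implicit.
Unset Printing Implicit Defensive.

Import Order.TTheory GRing.Theory Num.Theory.
Import numFieldNormedType.Exports.

Local Open Scope classical_set_scope.
Local Open Scope ring_scope.

(** * The Mazur-Orlicz theorem *)

Definition convex_subset (R : realType) (V : lmodType R) (A : set V) :=
  forall x y t, A x -> A y -> 0 <= t <= 1 -> A (t *: x + (1 - t) *: y).

Definition sublinear (R : realType) (V : lmodType R) (p : V -> R) :=
  (forall u v, p (u + v) <= p u + p v) /\
  (forall t u, 0 <= t -> p (t *: u) = t * p u).

Section MazurOrlicz.
Context {R : realType} {V : lmodType R}.
Implicit Types (p : V -> R) (Q : set (V * R^o)).

Lemma sublinear0 p : sublinear p -> p 0 = 0.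
Proof. by move=> [_ pZ]; rewrite -(scale0r 0) pZ// mul0r. Qed.

Lemma sublinear_of_le p : (forall u v, p (u + v) <= p u + p v) -> p 0 = 0 ->
  (forall t u, 0 < t -> p (t *: u) <= t * p u) -> sublinear p.
Proof.
move=> pD p0 pZ; split=> // t u t0.
have [->|tn0] := eqVneq t 0; first by rewrite scale0r mul0r.
have tp : 0 < t by rewrite lt_def tn0.
apply/eqP; rewrite eq_le pZ//= -ler_pdivlMl//.
by rewrite -{1}[u](scalerK tn0) pZ// invr_gt0.
Qed.

(** Lowering [p] to [tilt p Q] forces [b <= L v] for all [(v, b)] in [Q] and
every linear [L] below it. *)
Definition tilt_vals p Q u :=
  [set p (u + z.1 *: z.2.1) - z.1 * z.2.2 | z in
    [set z : R * (V * R^o) | 0 <= z.1 /\ Q z.2]].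

Definition tilt p Q u : R := inf (tilt_vals p Q u).

Section tilt.
Variables (p : V -> R) (Q : set (V * R^o)).
Hypotheses (subp : sublinear p) (Q0 : Q !=set0) (cQ : convex_subset Q).
Hypothesis Qp : forall v b, Q (v, b) -> b <= p v.

Let tilt_lb u : lbound (tilt_vals p Q u) (- p (- u)).
Proof.
move=> _ [[s [v b]] /= [s0 Qvb] <-].
have [pD pZ] := subp.
have := pD (u + s *: v) (- u); rewrite addrAC subrr add0r pZ// => h.
have : s * b <= s * p v by rewrite ler_wpM2l// Qp.
by lra.
Qed.

Let tilt_ne u : tilt_vals p Q u !=set0.
Proof.
have [[v b] Qvb] := Q0.
by exists (p (u + 0 *: v) - 0 * b); exists (0, (v, b)).
Qed.

Lemma tilt_le u v b s : 0 <= s -> Q (v, b) ->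
  tilt p Q u <= p (u + s *: v) - s * b.
Proof.
move=> s0 Qvb; apply: ge_inf; first by exists (- p (- u)); exact: tilt_lb.
by exists (s, (v, b)).
Qed.

Lemma le_tilt u x :
  (forall s v b, 0 <= s -> Q (v, b) -> x <= p (u + s *: v) - s * b) ->
  x <= tilt p Q u.
Proof.
move=> h; apply: lb_le_inf; first exact: tilt_ne.
by move=> _ [[s [v b]] /= [s0 Qvb] <-]; exact: h.
Qed.

Lemma tilt_le_id u : tilt p Q u <= p u.
Proof.
have [[v b] Qvb] := Q0.
by have := @tilt_le u v b 0 (lexx _) Qvb; rewrite scale0r addr0 mul0r subr0.
Qed.

Lemma tilt_sublinear : sublinear (tilt p Q).
Proof.
have [pD pZ] := subp; apply: sublinear_of_le => [u v||t u t0].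
- rewrite -lerBlDr; apply: le_tilt => s x b s0 Qxb.
  rewrite lerBlDr -lerBlDl; apply: le_tilt => s' y c s'0 Qyc.
  rewrite lerBlDl.
  have [ss0|ss0] := eqVneq (s + s') 0.
    have -> : s = 0 by apply/eqP; move: ss0 s0 s'0; lra.
    have -> : s' = 0 by apply/eqP; move: ss0 s0 s'0; lra.
    rewrite !scale0r !mul0r !addr0 !subr0; apply: le_trans (tilt_le_id _) _.
    by have := pD u v; lra.
  have ssp : 0 < s + s' by rewrite lt_def ss0 addr_ge0.
  (* tilting by s and by s' in turn is tilting by s + s' along a point of Q *)
  have [k [k01 E1 E2]] : exists k : R,
      [/\ 0 <= k <= 1, (s + s') * k = s & (s + s') * (1 - k) = s'].
    exists (s / (s + s')); split; last by field.
      by rewrite divr_ge0 ?ler_pdivrMr ?mul1r ?lerDl// ltW.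
    by field.
  have Qz : Q (k *: x + (1 - k) *: y, k * b + (1 - k) * c) := cQ Qxb Qyc k01.
  have := tilt_le (u + v) (ltW ssp) Qz.
  rewrite scalerDr !scalerA E1 E2 mulrDr !mulrA E1 E2 => h.
  have := pD (u + s *: x) (v + s' *: y); rewrite addrACA.
  by move: h; lra.
- apply/eqP; rewrite eq_le; apply/andP; split.
    by have := tilt_le_id 0; rewrite (sublinear0 subp).
  apply: le_tilt => s v b s0 Qvb; rewrite add0r pZ// -mulrBr mulr_ge0//.
  by rewrite subr_ge0 Qp.
- rewrite -ler_pdivrMl//; apply: le_tilt => s v b s0 Qvb.
  rewrite ler_pdivrMl//.
  have := @tilt_le (t *: u) v b (t * s) (mulr_ge0 (ltW t0) s0) Qvb.
  by rewrite -scalerA -scalerDr pZ ?(ltW t0)// -mulrA -mulrBr.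
Qed.

Lemma tiltN v b : Q (v, b) -> tilt p Q (- v) <= - b.
Proof.
move=> Qvb; apply: le_trans (tilt_le _ ler01 Qvb) _.
by rewrite scale1r addNr (sublinear0 subp) mul1r sub0r.
Qed.

End tilt.

Lemma sublinear_geN p u : sublinear p -> - p (- u) <= p u.
Proof.
move=> subp; have [pD _] := subp.
by have := pD u (- u); rewrite subrr (sublinear0 subp); lra.
Qed.

(** Zorn's lemma applies because the infimum of a chain of sublinear
functionals [q] is sublinear; it is finite by the bound [- p (- u) <= q u]
valid below [p]. *)
Lemma minimal_sublinear p : sublinear p ->
  exists q, [/\ sublinear q, forall u, q u <= p u &
    forall r, sublinear r -> (forall u, r u <= q u) -> forall u, q u <= r u].
Proof.
move=> subp.
pose T := {q : V -> R | sublinear q /\ forall u, q u <= p u}.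
pose le (q r : T) : bool := `[< forall u, sval r u <= sval q u >].
have t0 : T by exists p.
have [| | |q qmin] := @ZL_preorder T t0 le.
- by move=> q; apply/asboolP.
- by move=> r q s /asboolP rq /asboolP qs; apply/asboolP => u; exact: le_trans (qs u) (rq u).
- move=> A totA; have [[q0 Aq0]|A0] := pselect (A !=set0); last first.
    by exists t0 => s As; exfalso; apply: A0; exists s.
  pose m u := inf [set sval q u | q in A].
  have lbm u : lbound [set sval q u | q in A] (- p (- u)).
    move=> _ [q Aq <-]; case: q Aq => q [sq qp] _ /=.
    by apply: le_trans (sublinear_geN _ sq); rewrite lerN2.
  have mle q u : A q -> m u <= sval q u.
    by move=> Aq; apply: ge_inf; [exists (- p (- u)); exact: lbm | exists q].
  have lem u x : (forall q, A q -> x <= sval q u) -> x <= m u.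
    move=> h; apply: lb_le_inf; first by exists (sval q0 u); exists q0.
    by move=> _ [q Aq <-]; exact: h.
  have subm : sublinear m.
    apply: sublinear_of_le => [u v||t u t0'].
    - suff h q r : A q -> A r -> m (u + v) <= sval q u + sval r v.
        rewrite -lerBlDr; apply: (lem _ _) => q Aq.
        have : m (u + v) - sval q u <= m v.
          by apply: (lem _ _) => r Ar; rewrite lerBlDl h.
        by lra.
      move=> Aq Ar.
      (* the smaller of the two comparable functionals serves for both *)
      have [/asboolP qr|/asboolP qr] := totA _ _ Aq Ar.
        apply: le_trans (mle _ _ Ar) _; case: (svalP r) => -[rD _] _.
        by apply: le_trans (rD _ _) _; rewrite lerD2r qr.
      apply: le_trans (mle _ _ Aq) _; case: (svalP q) => -[rD _] _.
      by apply: le_trans (rD _ _) _; rewrite lerD2l qr.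
    - apply/eqP; rewrite eq_le; apply/andP; split.
        apply: le_trans (mle _ _ Aq0) _; case: (svalP q0) => sq _.
        by rewrite sublinear0.
      by apply: (lem _ _) => q Aq; case: (svalP q) => sq _; rewrite sublinear0.
    - rewrite -ler_pdivrMl//; apply: (lem _ _) => q Aq; rewrite ler_pdivrMl//.
      apply: le_trans (mle _ _ Aq) _; case: (svalP q) => -[_ qZ] _.
      by rewrite qZ// ltW.
  have mp u : m u <= p u.
    apply: le_trans (mle _ _ Aq0) _; case: (svalP q0) => _; exact.
  exists (exist _ m (conj subm mp)) => s As; apply/asboolP => u; exact: mle.
exists (sval q); case: (svalP q) => sq qp; split=> // r sr rq u.
have rp v : r v <= p v by apply: le_trans (rq v) (qp v).
have /(qmin (exist _ r (conj sr rp)))/asboolP : le q (exist _ r (conj sr rp)) by apply/asboolP.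
exact.
Qed.

(** A minimal sublinear functional [L] below [tilt p Q] is linear: tilting [L]
along a pair [(v, L v)] cannot lower it any more, so [L (- v) <= - L v]. This
is the only form of the Hahn-Banach theorem used below. *)
Theorem mazur_orlicz p Q : sublinear p -> Q !=set0 -> convex_subset Q ->
  (forall v b, Q (v, b) -> b <= p v) ->
  exists L : V -> R, [/\ linear (L : V -> R^o), forall v, L v <= p v &
    forall v b, Q (v, b) -> b <= L v].
Proof.
move=> subp Q0 cQ Qp.
have [L [subL Lq Lmin]] := minimal_sublinear (tilt_sublinear subp Q0 cQ Qp).
have LN v : L (- v) <= - L v.
  pose Q1 : set (V * R^o) := [set (v, L v)].
  have cQ1 : convex_subset Q1.
    move=> _ _ t -> -> _; rewrite /Q1/=; congr pair.
      by rewrite /= -scalerDl addrC subrK scale1r.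
    by rewrite /= -scalerDl addrC subrK scale1r.
  have Q1n : Q1 !=set0 by exists (v, L v).
  have Q1L u b : Q1 (u, b) -> b <= L u by move=> [-> ->].
  have := Lmin _ (tilt_sublinear subL Q1n cQ1 Q1L) (tilt_le_id subL Q1n Q1L) (- v).
  by move=> /le_trans; apply; exact: tiltN.
have LD u v : L (u + v) = L u + L v.
  apply/eqP; rewrite eq_le; have [-> _/=] := subL.
  have [LD _] := subL; have := LD (u + v) (- v); rewrite addrK.
  by have := LN v; lra.
have LNE v : L (- v) = - L v.
  by have := LD v (- v); rewrite subrr (sublinear0 subL); lra.
exists L; split.
- move=> a u v; rewrite LD; congr (_ + _).
  have [_ LZ] := subL.
  have [a0|a0] := leP 0 a; first exact: LZ.
  have -> : a *: u = - ((- a) *: u) by rewrite scaleNr opprK.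
  by rewrite LNE LZ ?oppr_ge0 ?(ltW a0)// mulNr opprK.
- by move=> v; apply: le_trans (Lq v) (tilt_le_id _ _ _ _).
- move=> v b Qvb; have := le_trans (Lq (- v)) (tiltN subp Qp Qvb).
  by rewrite LNE lerN2.
Qed.

End MazurOrlicz.

(** * Means, affine minorants and Goldstine's theorem *)

Section BoundedFunctions.
Context {R : realType} {T : Type} (A : set T).

Definition bounded_on (u : T -> R) := exists M, forall t, A t -> `|u t| <= M.

Definition bounded_on_pred : {pred (T -> R)} := [pred u | `[< bounded_on u >]].

Record boundedf := BoundedF { boundedf_fun :> T -> R ; _ : boundedf_fun \in bounded_on_pred }.

HB.instance Definition _ := [isSub for boundedf_fun].
HB.instance Definition _ := [Choice of boundedf by <:].

Lemma bounded_on_submod : submod_closed bounded_on_pred.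
Proof.
split; first by apply/asboolP; exists 0 => t _; rewrite /= normr0.
move=> a u v /asboolP[M uM] /asboolP[N vN]; apply/asboolP.
exists (`|a| * M + N) => t At; apply: le_trans (ler_normD _ _) _.
by rewrite lerD ?vN// normrM ler_wpM2l// uM.
Qed.

HB.instance Definition _ :=
  GRing.isSubmodClosed.Build R (T -> R) bounded_on_pred bounded_on_submod.
HB.instance Definition _ := [SubChoice_isSubLmodule of boundedf by <:].

Lemma boundedfP (u : boundedf) : bounded_on u.
Proof. by case: u => u /= /asboolP. Qed.

Lemma bounded_onD u v : bounded_on u -> bounded_on v -> bounded_on (u + v).
Proof.
move=> [M uM] [N vN]; exists (M + N) => t At.
by apply: le_trans (ler_normD _ _) _; rewrite lerD ?uM ?vN.
Qed.

Lemma bounded_onM u v : bounded_on u -> bounded_on v -> bounded_on (u * v).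
Proof.
move=> [M uM] [N vN]; exists (M * N) => t At.
by rewrite normrM ler_pM ?uM ?vN.
Qed.

Lemma bounded_on_cst c : bounded_on (fun=> c).
Proof. by exists `|c|. Qed.

(** Such an [L] is a finitely additive probability on [A]; its values on
functions unbounded on [A] are junk. *)
Record mean (L : (T -> R) -> R) : Prop := Mean {
  meanD : forall u v, bounded_on u -> bounded_on v -> L (u + v) = L u + L v ;
  meanZ : forall a u, bounded_on u -> L (a *: u) = a * L u ;
  mean_le : forall u v, bounded_on u -> bounded_on v ->
    (forall t, A t -> u t <= v t) -> L u <= L v ;
  mean1 : L (fun=> 1) = 1 }.

(** Apply the Mazur-Orlicz theorem to the supremum over [A], paired on [Y]
with the constant [g]: lying below the supremum makes the functional positive
and normalised. *)
Lemma separating_mean (Y : set (T -> R)) (g : R) : A !=set0 -> Y !=set0 ->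
  convex_subset Y -> (forall y, Y y -> bounded_on y) ->
  (forall y, Y y -> exists2 t, A t & g <= y t) ->
  exists2 L, mean L & forall y, Y y -> g <= L y.
Proof.
move=> [t0 At0] [y0 Yy0] cY bY gY.
pose p (u : boundedf) := sup [set u t | t in A].
have ubp (u : boundedf) : has_ubound [set u t | t in A].
  have [M uM] := boundedfP u; exists M => _ [t At <-].
  exact: le_trans (ler_norm _) (uM t At).
have p_ge (u : boundedf) t : A t -> u t <= p u.
  by move=> At; apply: ub_le_sup; [exact: ubp|exists t].
have p_le (u : boundedf) M : (forall t, A t -> u t <= M) -> p u <= M.
  by move=> uM; apply: ge_sup => [|_ [t At <-]]; [exists (u t0); exists t0|exact: uM].
have subp : sublinear p.
  apply: sublinear_of_le => [u v||a u a0].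
  - by apply: p_le => t At /=; rewrite lerD// p_ge.
  - by apply/eqP; rewrite eq_le p_le//=; exact: p_ge (0 : boundedf) _ At0.
  - by apply: p_le => t At /=; rewrite ler_wpM2l ?(ltW a0)// p_ge.
pose Q : set (boundedf * R^o) := [set z : boundedf * R^o | Y z.1 /\ z.2 = g].
have mk u : bounded_on u -> {v : boundedf | (v : T -> R) = u}.
  move=> bu; have bu' : u \in bounded_on_pred by apply/asboolP.
  by exists (BoundedF bu').
have [] := @mazur_orlicz R boundedf p Q subp.
- by have [v vE] := mk _ (bY _ Yy0); exists (v, g); split => //=; rewrite vE.
- move=> [u b] [v c] t [/= Yu ->] [/= Yv ->] t01; split => /=; last first.
    by rewrite -mulrDl addrC subrK mul1r.
  exact: cY.
- by move=> v b [/= Yv ->]; have [t At gv] := gY _ Yv; apply: le_trans (p_ge v t At).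
move=> L0 [linL Lp QL].
pose L u := if insub u is Some v then L0 v else 0.
have LE (v : boundedf) : L v = L0 v by rewrite /L valK.
pose lL : {linear boundedf -> R^o} :=
  HB.pack L0 (GRing.isLinear.Build R boundedf R^o *:%R L0 linL).
exists L; last first.
  by move=> y Yy; have [v vE] := mk _ (bY _ Yy); rewrite -vE LE QL//; split; rewrite //= vE.
have L1 : forall v : boundedf, (forall t, A t -> v t <= 0) -> L0 v <= 0.
  by move=> v v0; apply: le_trans (Lp v) (p_le _ _ v0).
split.
- move=> u v /mk[u' <-] /mk[v' <-]; rewrite -[X in L X]/(val (u' + v')) !LE.
  exact: (raddfD lL).
- move=> a u /mk[u' <-]; rewrite -[X in L X]/(val (a *: u')) !LE.
  exact: (linearZ_LR lL).
- move=> u v /mk[u' <-] /mk[v' <-] uv; rewrite !LE -subr_le0.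
  rewrite -[leLHS](raddfB lL); apply: L1 => t At /=.
  by rewrite subr_le0 uv.
- have [v vE] := mk _ (bounded_on_cst 1); rewrite -vE LE.
  apply/eqP; rewrite eq_le; apply/andP; split.
    by apply: le_trans (Lp v) (p_le _ _ _) => t _; rewrite vE.
  rewrite -lerN2 -[leLHS](raddfN lL); apply: le_trans (Lp _) (p_le _ _ _) => t _ /=.
  by rewrite vE.
Qed.

End BoundedFunctions.

Section DualFacts.
Context {R : realType} {E : normedModType R}.

Lemma dual_bound (phi : dual E) x : `|phi x| <= `|phi| * `|x|.
Proof.
have [->|x0] := eqVneq x 0; first by rewrite linear0 !normr0 mulr0.
have := @dual_norm_ub _ _ phi (`|x|^-1 *: x).
rewrite normrZ normfV normr_id mulVf ?normr_eq0// => /(_ (lexx _)).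
by rewrite linearZ/= normrM normfV normr_id mulrC ler_pdivrMr// normr_gt0.
Qed.

Lemma dual_of_bounded (L : E -> R) (k : R) : linear (L : E -> R^o) ->
  (forall x, L x <= k * `|x|) -> exists phi : dual E, forall x, phi x = L x.
Proof.
move=> linL Lk.
pose lL : {linear E -> R^o} := HB.pack L (GRing.isLinear.Build R E R^o *:%R L linL).
have absL x : `|L x| <= k * `|x|.
  rewrite ler_norml Lk andbT lerNl -[leLHS](raddfN lL).
  by apply: le_trans (Lk _) _; rewrite normrN.
have cL : continuous L.
  apply/(linear_bounded_continuous lL)/bounded_funP => r; exists (`|k| * `|r|) => x xr.
  apply: le_trans (absL x) _.
  apply: (@le_trans _ _ (`|k| * `|x|)); first by rewrite ler_wpM2r// ler_norm.
  by rewrite ler_wpM2l// (le_trans xr)// ler_norm.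
have PL : L \in @dual_pred _ E by apply/asboolP; split.
by exists (Dual PL).
Qed.

Lemma dual_apply_sum (I : Type) (s : seq I) (c : I -> R) (F : I -> dual E) x :
  (\sum_(i <- s) c i *: F i) x = \sum_(i <- s) c i * F i x.
Proof.
elim: s => [|i s IH]; first by rewrite !big_nil.
by rewrite !big_cons -IH.
Qed.

(** The lower bound [m] and semicontinuity at [x0] give
[t <= f x + k * `|x0 - x|] for [k] large. The Mazur-Orlicz theorem for the
multiple [k] of the norm then replaces that multiple by a linear form. *)
Lemma affine_minorant (f : E -> \bar R) (m : R) (x0 : E) (t : R) :
  lower_semicontinuous f -> convex_efun f -> (forall x, (m%:E <= f x)%E) ->
  (exists x, f x != +oo%E) -> (t%:E < f x0)%E ->
  exists (X : dual E) (c : R),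
    (forall x, ((X x + c)%:E <= f x)%E) /\ t <= X x0 + c.
Proof.
move=> lscf cvxf fm [x1 fx1] tf.
have [V /nbhs_ballP[e /= e0 eV] Vt] := lscf _ _ tf.
have fin x : f x != +oo%E -> exists a, f x = a%:E.
  by move=> fx; exists (fine (f x)); rewrite fineK// fin_numE fx andbT; case: (f x) (fm x).
(* outside the ball of radius e, the slope k lifts m above t *)
pose k := `|t - m| / e.
have fk x a : f x = a%:E -> t - a <= k * `|x0 - x|.
  move=> fxa; have [xe|xe] := ltP `|x0 - x| e.
    have : (t%:E < f x)%E by apply: Vt; apply: eV; rewrite -ball_normE.
    rewrite fxa lte_fin => ta; apply: (@le_trans _ _ 0); first by rewrite subr_le0 ltW.
    by rewrite mulr_ge0// divr_ge0// ltW.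
  have := fm x; rewrite fxa lee_fin => ma.
  apply: (@le_trans _ _ (k * e)).
    by rewrite divfK ?gt_eqF//; have := ler_norm (t - m); lra.
  by rewrite ler_wpM2l// divr_ge0// ltW.
pose p (v : E) := k * `|v|.
have k0 : 0 <= k by rewrite divr_ge0// ltW.
have subp : sublinear p.
  split=> [u v|a u a0]; first by rewrite /p -mulrDr ler_wpM2l// ler_normD.
  by rewrite /p normrZ ger0_norm// mulrCA.
pose Q : set (E * R^o) := [set z : E * R^o | (f (x0 - z.1)%R <= (t - z.2)%:E)%E].
have [] := @mazur_orlicz R E p Q subp.
- have [a fa] := fin _ fx1; exists (x0 - x1, t - a) => /=.
  by rewrite /Q/= subKr subKr fa.
- move=> [u b] [v c] s; rewrite /Q/= => fu fv s01.
  have -> : x0 - (s *: u + (1 - s) *: v) = s *: (x0 - u) + (1 - s) *: (x0 - v).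
    rewrite !scalerBr addrACA -scalerDl addrC (addrC s) subrK scale1r addrC.
    by rewrite opprD.
  apply: le_trans (cvxf _ _ _ s01) _.
  have -> : t - (s *: b + (1 - s) *: c : R^o) = s * (t - b) + (1 - s) * (t - c) :> R.
    by rewrite /GRing.scale/=; ring.
  by rewrite [leRHS]EFinD !EFinM leeD// lee_wpmul2l// lee_fin; lra.
- move=> v b; rewrite /Q/= => fvb.
  have [|a fa] := fin (x0 - v); first by case: (f _) fvb.
  by have := fk _ _ fa; rewrite subKr; move: fvb; rewrite fa lee_fin /p; lra.
move=> L [linL Lp QL].
have [X XE] := dual_of_bounded linL Lp.
exists X, (t - X x0); split; last by lra.
move=> x; have [->|/fin[a fa]] := eqVneq (f x) +oo%E; first exact: leey.
have : t - a <= L (x0 - x) by apply: QL; rewrite /Q/= subKr subKr fa.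
by rewrite fa lee_fin -XE linearB/=; lra.
Qed.

End DualFacts.

Section Goldstine.
Context {R : realType} {E : normedModType R}.

(** Only the finitely many values at [P] matter. If no [x] were suitable, a
linear form on the space of these values would give a functional [psi] with
[psi x - X psi >= e] for all [x] in the ball, whereas the infimum of [psi] on
the ball is [- r * `|psi|]. *)
Lemma goldstine (X : dual (dual E)) (r : R) (P : seq (dual E)) (e : R) :
  `|X| <= r -> 0 < e ->
  exists2 x, `|x| <= r & forall phi, phi \in P -> `|phi x - X phi| < e.
Proof.
move=> Xr e0; apply: contrapT => noP.
pose n := size P; pose F (i : 'I_n) : dual E := nth 0 P i.
pose w (x : E) : 'rV[R^o]_n := \row_i (F i x - X (F i)).
pose p (v : 'rV[R^o]_n) : R := \sum_i `|v 0 i|.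
have subp : sublinear p.
  split=> [u v|a u a0].
    by rewrite /p -big_split/= ler_sum// => i _; rewrite mxE ler_normD.
  by rewrite /p mulr_sumr; apply: eq_bigr => i _; rewrite mxE normrM ger0_norm.
pose Q : set ('rV[R^o]_n * R^o) := [set z | exists2 x, `|x| <= r & z = (w x, e)].
have r0 : 0 <= r by apply: le_trans Xr.
have [] := @mazur_orlicz R _ p Q subp.
- by exists (w 0, e); exists 0; rewrite ?normr0.
- move=> _ _ s [x xr ->] [y yr ->] /andP[s0 s1]; exists (s *: x + (1 - s) *: y).
    apply: le_trans (ler_normD _ _) _; rewrite !normrZ !ger0_norm ?subr_ge0//.
    have : s * `|x| <= s * r by rewrite ler_wpM2l.
    have : (1 - s) * `|y| <= (1 - s) * r by rewrite ler_wpM2l// subr_ge0.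
    by lra.
  congr pair; last by rewrite /= -mulrDl addrC subrK mul1r.
  have aff (a b c : R) : s * (a - c) + (1 - s) * (b - c) = s * a + (1 - s) * b - c.
    by ring.
  by apply/rowP => i; rewrite !mxE linearD !linearZ/= /GRing.scale/= aff.
- move=> v b [x xr [-> ->]]; apply: contrapT => /negP; rewrite -ltNge => pe.
  apply: noP; exists x => // phi /(nthP 0)[i iP <-].
  apply: le_lt_trans pe; rewrite /p (bigD1 (Ordinal iP))//= mxE.
  by rewrite lerDl sumr_ge0.
move=> L [linL Lp QL].
pose lL : {linear 'rV[R^o]_n -> R^o} :=
  HB.pack L (GRing.isLinear.Build R 'rV[R^o]_n R^o *:%R L linL).
(* the linear form L on coordinates, read as a combination of the functionals *)
pose psi : dual E := \sum_i (L (delta_mx 0 i)) *: F i.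
have psiE x : L (w x) = psi x - X psi.
  rewrite [X in L X]row_sum_delta -[LHS]/(lL _) linear_sum/= dual_apply_sum.
  rewrite [X psi]linear_sum/= -sumrB; apply: eq_bigr => i _.
  rewrite [L (_ *: _)](linearZ_LR lL) (linearZ_LR X) /GRing.scale/= mxE.
  by rewrite mulrC mulrBr.
have h x : `|x| <= r -> e <= psi x - X psi.
  by move=> xr; rewrite -psiE; apply: QL; exists x.
have Xpsi : `|X psi| <= r * `|psi|.
  by apply: le_trans (dual_bound X psi) _; rewrite ler_wpM2r.
have : `|psi| * r <= - e - X psi.
  have [->|rn0] := eqVneq r 0.
    have := h 0; rewrite normr0 linear0 => /(_ r0); rewrite mulr0; lra.
  have rp : 0 < r by rewrite lt_def rn0.
  rewrite -ler_pdivlMr//; apply: dual_norm_le => x x1.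
  rewrite ler_pdivlMr//.
  have rx : `|r *: x| <= r by rewrite normrZ ger0_norm// ler_piMr.
  have := h _ rx; have := h (- (r *: x)); rewrite normrN => /(_ rx).
  rewrite linearN !linearZ/= /GRing.scale/=.
  have [a0|a0] := leP 0 (psi x); [rewrite ger0_norm//|rewrite ltr0_norm//]; nra.
by move: Xpsi; rewrite ler_norml => /andP[+ _]; lra.
Qed.

End Goldstine.

(** * Sequences that span l^1 *)

Section Ell1Copy.
Context {R : realType} {E : completeNormedModType R}.
Variables (x : nat -> E) (r k : R).
Hypotheses (xr : forall n, `|x n| <= r) (k0 : 0 < k).
Hypothesis kx : forall n (c : nat -> R),
  k * \sum_(0 <= i < n) `|c i| <= `|\sum_(0 <= i < n) c i *: x i|.

Let r0 : 0 <= r.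
Proof. exact: le_trans (xr 0). Qed.

Let term (a : nat -> R) : nat -> E := fun i => a i *: x i.

Let term_le (a : nat -> R) n : `|term a n| <= r * `|a n|.
Proof. by rewrite normrZ mulrC ler_wpM2r. Qed.

Let cvg_normed_term (a : nat -> R) : cvgn [normed series a] ->
  cvgn [normed series (term a)].
Proof.
move=> ca; apply: (@series_le_cvg _ _ (r *: (fun n => `|a n|) : R ^nat)) => [n|n|n|].
- exact: normr_ge0.
- by rewrite !fctE mulr_ge0.
- exact: term_le.
- exact: is_cvg_seriesZ.
Qed.

Let cvg_term (a : nat -> R) : cvgn [normed series a] -> cvgn (series (term a)).
Proof. by move=> ca; apply: normed_cvg; exact: cvg_normed_term. Qed.

Let T (a : ell1 R) : E := limn (series (term a)).

Let linT : linear T.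
Proof.
move=> c a b; rewrite /T.
have -> : series (term (c *: a + b)) = c *: series (term a) + series (term b).
  rewrite -seriesZ -seriesD; congr series; apply/funext => i.
  by rewrite !fctE /term/= scalerDl scalerA.
have ca := cvg_term (@ell1_cvg _ a); have cb := cvg_term (@ell1_cvg _ b).
by rewrite limD//; [rewrite limZl_tmp//|exact: is_cvgZl_tmp].
Qed.

Let T_le (a : ell1 R) : `|T a| <= r * `|a|.
Proof.
apply: le_trans (lim_series_norm (cvg_normed_term (@ell1_cvg _ a))) _.
rewrite -[leRHS](lim_seriesZ _ (@ell1_cvg _ a)); apply: lim_series_le.
- exact: cvg_normed_term (@ell1_cvg _ a).
- exact: is_cvg_seriesZ (@ell1_cvg _ a).
- by move=> n; exact: term_le.
Qed.

Let T_ge (a : ell1 R) : k * `|a| <= `|T a|.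
Proof.
rewrite -[leLHS](lim_seriesZ _ (@ell1_cvg _ a)) /T.
have ct := cvg_term (@ell1_cvg _ a).
rewrite -lim_norm//; apply: ler_lim.
- exact: is_cvg_seriesZ (@ell1_cvg _ a).
- exact: is_cvg_norm.
- by near=> n; rewrite seriesZ; exact: kx.
Unshelve. all: by end_near. Qed.

Let lT : {linear ell1 R -> E} := HB.pack T (GRing.isLinear.Build R _ _ _ T linT).

Let contT : continuous T.
Proof.
apply/(linear_bounded_continuous lT)/bounded_funP => M; exists (r * `|M|) => a aM.
by apply: le_trans (T_le a) _; rewrite ler_wpM2l// (le_trans aM)// ler_norm.
Qed.

Let ell1_coord (a : ell1 R) n : \sum_(0 <= i < n) `|a i| <= `|a|.
Proof.
have nda : nondecreasing_seq [normed series a].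
  by apply: nondecreasing_series => i _ _; exact: normr_ge0.
exact: nondecreasing_cvgn_le nda (@ell1_cvg _ a) n.
Qed.

(** The preimages of a sequence converging in the range are Cauchy. Their
coordinatewise limit is summable, and they converge to it in norm. *)
Let closedT : closed (range T).
Proof.
move=> y cly.
(* the factor k / 2 makes the preimages satisfy dP with rate 1 / (n + 1) *)
have /choice[a aP] : forall n, exists a : ell1 R, `|y - T a| < (k * n.+1%:R^-1) / 2.
  move=> n; have e0 : 0 < (k * n.+1%:R^-1) / 2 by rewrite divr_gt0 ?mulr_gt0.
  have /cly[_ [[a _ <-]]] := nbhsx_ballx y _ e0.
  by rewrite -ball_normE => ?; exists a.
have mono n m : (n <= m)%N -> m.+1%:R^-1 <= n.+1%:R^-1 :> R.
  by move=> nm; rewrite lef_pV2 ?posrE ?ler_nat.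
have dP n m : (n <= m)%N -> `|a n - a m| <= n.+1%:R^-1.
  move=> nm; have := T_ge (a n - a m).
  rewrite -[T _]/(lT _) linearB/= => h; rewrite -(ler_pM2l k0).
  apply: le_trans h _.
  have -> : T (a n) - T (a m) = (y - T (a m)) - (y - T (a n)).
    by rewrite opprB [RHS]addrC addrA subrK.
  apply: le_trans (ler_normB _ _) _.
  have : k * m.+1%:R^-1 <= k * n.+1%:R^-1 by rewrite ler_wpM2l ?mono// ltW.
  have := aP m; have := aP n.
  by move: (k / n.+1%:R) (k / m.+1%:R) => ? ?; lra.
have coord n m i : (n <= m)%N -> `|a n i - a m i| <= n.+1%:R^-1.
  move=> /dP; apply: le_trans; apply: le_trans (ell1_coord (a n - a m) i.+1).
  by rewrite big_nat_recr//= lerDr sumr_ge0.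
have inv_small (e : R) : 0 < e -> exists n : nat, n.+1%:R^-1 < e.
  move=> e0; exists (Num.truncn e^-1); rewrite invf_plt ?posrE//.
  exact: truncnS_gt.
have cvgi i : cvgn (fun m => a m i).
  apply/cauchy_cvgP/cauchy_exP => e /inv_small[n ne].
  exists (a n i), n => // m /= nm; rewrite -ball_normE/=.
  exact: le_lt_trans (coord n m i nm) ne.
pose b i := limn (fun m => a m i).
have ab n N : \sum_(0 <= i < N) `|a n i - b i| <= n.+1%:R^-1.
  have c : (fun m => \sum_(0 <= i < N) `|a n i - a m i|) @ \oo -->
      \sum_(0 <= i < N) `|a n i - b i|.
    apply: cvg_big => [|i _]; first exact: add_continuous.
    by apply: cvg_norm; apply: cvgB; [exact: cvg_cst|exact: cvgi].
  rewrite -(cvg_lim _ c)//; apply: limr_le; first by apply/cvg_ex; eexists; exact: c.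
  near=> m; apply: le_trans (ell1_coord (a n - a m) N) _; apply: dP.
  by near: m; exists n.
have cab n : cvgn [normed series ((a n : nat -> R) - b)].
  apply: nondecreasing_is_cvgn.
    by apply: nondecreasing_series => i _ _; exact: normr_ge0.
  by exists n.+1%:R^-1 => _ [N _ <-]; exact: ab.
have Pab n : (a n : nat -> R) - b \in @ell1_pred R by apply/asboolP; exact: cab.
pose w n : ell1 R := Ell1 (Pab n).
have wle n : `|w n| <= n.+1%:R^-1.
  apply: limr_le; first exact: cab.
  by apply: nearW => N; exact: ab.
(* a n - w n is the limit b, whatever n is *)
exists (a 0%N - w 0%N) => //.
have bE n : a n - w n = a 0%N - w 0%N.
  by apply/val_inj/funext => i /=; rewrite !fctE !subKr.
apply/eqP; rewrite -subr_eq0 -normr_le0; apply/ler_addgt0Pl => e e0.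
rewrite addr0.
have e1 : 0 < e / (r + k) by rewrite divr_gt0// ltr_wpDl.
have [n ne] := inv_small _ e1.
rewrite -(bE n).
have -> : T (a n - w n) - y = - (y - T (a n)) - T (w n).
  by rewrite -[T (_ - _)]/(lT _) linearB/= opprB addrAC.
apply: le_trans (ler_normB _ _) _; rewrite normrN.
have h1 := aP n; have h2 := T_le (w n).
have h3 : r * `|w n| <= r * n.+1%:R^-1 by rewrite ler_wpM2l// wle.
have h4 : (r + k) * n.+1%:R^-1 < e by rewrite mulrC -ltr_pdivlMr// ltr_wpDl.
have h5 : 0 <= k * n.+1%:R^-1 by rewrite mulr_ge0// ltW.
by move: h1 h2 h3 h4 h5; rewrite mulrDl; move: (n.+1%:R^-1) => v; lra.
Unshelve. all: by end_near. Qed.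

(** The map sending [a] to the sum of the [a i *: x i] is bounded because [x]
is bounded, and bounded below by the lower estimate on finite sums; so it is
an isomorphism onto a closed subspace. *)
Lemma ell1_copy_of_lower_bound : contains_copy_of (ell1 R) E.
Proof.
pose S (y : E) : ell1 R := xget 0 [set a | T a = y].
have TK : cancel T S.
  move=> a; have Tinj b : T b = T a -> b = a.
    move=> Tba; apply/eqP; rewrite -subr_eq0 -normr_le0 -(pmulr_rle0 _ k0).
    by apply: le_trans (T_ge _) _; rewrite -[T _]/(lT _) linearB/= Tba subrr normr0.
  by apply: Tinj; apply: (@xgetPex _ 0 [set b | T b = T a]); exists a.
exists (range T); split; first exact: closedT.
- split; first by apply/mem_set; exists 0 => //; rewrite -[T 0]/(lT 0) linear0.
  move=> c _ _ /set_mem[a _ <-] /set_mem[b _ <-]; apply/mem_set.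
  by exists (c *: a + b) => //; rewrite linT.
- exists lT, S; split => //.
  apply/subspace_continuousP => _ [a _ <-].
  apply/cvgrPdist_lt => e e0.
  rewrite /= near_withinE; near=> z => -[b _ zE].
  suff h : `|a - b| < e by move: h; rewrite -{1}(TK a) -{1}(TK b) zE.
  rewrite -(ltr_pM2l k0); apply: le_lt_trans (T_ge _) _.
  rewrite -[T _]/(lT _) linearB/= zE.
  by near: z; apply: cvgr_dist_lt; rewrite ?mulr_gt0.
Unshelve. all: by end_near. Qed.

End Ell1Copy.

(** * Independent sequences from splitting families *)

Definition below (R : realType) (E : normedModType R) (x : E) (c : R) :
    set (dual E) := [set phi | phi x < c].
Definition above (R : realType) (E : normedModType R) (x : E) (c : R) :
    set (dual E) := [set phi | c < phi x].

Section Tree.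
Context {R : realType} {E : completeNormedModType R}.
Variables (RR : set (set (dual E))) (r rho a b : R).
Hypotheses (ab : a < b) (rho0 : 0 < rho).
Hypothesis RR0 : RR !=set0.
Hypothesis RRne : forall U, RR U -> U !=set0.
Hypothesis RRrho : forall U, RR U -> forall phi, U phi -> `|phi| <= rho.

Hypothesis RR_split : forall (I : finType) (U : I -> set (dual E)),
  (forall i, RR (U i)) -> exists2 x, `|x| <= r &
    forall i, RR (U i `&` below x a) /\ RR (U i `&` above x b).

Let side (s : bool) (x : E) : set (dual E) := if s then above x b else below x a.

Let good n (V : seq bool -> set (dual E)) : set E := [set x | `|x| <= r /\
  forall (t : n.-tuple bool) s, RR (V t `&` side s x)].

Let root : set (dual E) := get RR.

(** The node of level [n] reached by the branch [t], whose last choice comes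
first. One vector cuts all the nodes of a level. *)
Fixpoint tree n : seq bool -> set (dual E) :=
  if n isn't m.+1 then fun=> root
  else fun t => tree m (behead t) `&` side (head false t) (get (good m (tree m))).

Let x n : E := get (good n (tree n)).

Let tree_RR n : forall t : n.-tuple bool, RR (tree n t).
Proof.
elim: n => [t|n IH t]; first exact: getPex.
have [_ h] : good n (tree n) (x n).
  apply: getPex; have [y yr yU] := RR_split IH.
  exists y; split=> // t' [] /=; by case: (yU t').
have := h [tuple of behead t] (head false t); exact.
Qed.

Let xP n : good n (tree n) (x n).
Proof.
apply: getPex; have [y yr yU] := RR_split (tree_RR (n := n)).
by exists y; split=> // t' [] /=; case: (yU t').
Qed.

Let code (s : nat -> bool) n := rev (mkseq s n).

Let codeS s n : code s n.+1 = s n :: code s n.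
Proof. by rewrite /code mkseqS rev_rcons. Qed.

Let tree_sides s n phi : tree n (code s n) phi ->
  forall i, (i < n)%N -> side (s i) (x i) phi.
Proof.
elim: n => // n IH; rewrite codeS /= => -[/IH h hn] i.
by rewrite ltnS leq_eqVlt => /orP[/eqP ->|/h].
Qed.

Let independent n (s : nat -> bool) :
  exists2 phi, `|phi| <= rho & forall i, (i < n)%N -> side (s i) (x i) phi.
Proof.
have sz : size (code s n) == n by rewrite size_rev size_mkseq.
have RRt := tree_RR (Tuple sz); have [phi tphi] := RRne RRt.
by exists phi; [exact: RRrho RRt _ tphi|exact: tree_sides tphi].
Qed.

(** By construction of the tree, every sign pattern for [x 0, ..., x n] is
realised by a functional of norm at most [rho]. For coefficients [c], take
[phi] realising the signs of [c] and [psi] realising the opposite signs: then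
[phi - psi], of norm at most [2 * rho], takes a value at least [b - a] times
the sum of the absolute values of [c] at the combination of the [x i]. *)
Lemma ell1_copy_of_tree : contains_copy_of (ell1 R) E.
Proof.
have k0 : 0 < (b - a) / (2 * rho) by rewrite divr_gt0 ?subr_gt0 ?mulr_gt0.
apply: (@ell1_copy_of_lower_bound _ _ x r _ _ k0) => [n|n c]; first by case: (xP n).
have [phi phir phis] := independent n (fun i => 0 <= c i).
have [psi psir psis] := independent n (fun i => c i < 0).
set v := \sum_(0 <= i < n) c i *: x i.
have vE (f : dual E) : f v = \sum_(0 <= i < n) c i * f (x i).
  by rewrite /v linear_sum; apply: eq_bigr => i _; rewrite linearZ.
have h : (b - a) * \sum_(0 <= i < n) `|c i| <= phi v - psi v.
  rewrite !vE -sumrB mulr_sumr !big_mkord; apply: ler_sum => i _.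
  have := phis i (ltn_ord i); have := psis i (ltn_ord i).
  rewrite /side; have [ci|ci] := leP 0 (c i) => /=.
    by rewrite ger0_norm// /below /above/= => h1 h2; nra.
  by rewrite ltr0_norm// /below /above/= => h1 h2; nra.
have h1 := dual_bound phi v; have h2 := dual_bound psi v.
have h3 : `|phi| * `|v| <= rho * `|v| by rewrite ler_wpM2r.
have h4 : `|psi| * `|v| <= rho * `|v| by rewrite ler_wpM2r.
have h5 := ler_norm (phi v); have h6 := ler_norm (- psi v).
rewrite normrN in h6.
rewrite mulrAC ler_pdivrMr ?mulr_gt0//.
by apply: le_trans h _; lra.
Qed.

End Tree.

(** * The weak* topology on bounded sets *)

Section WeakStar.
Context {R : realType} {E : normedModType R}.

Lemma weak_star_eval_continuous (x : E) :
  continuous (fun phi : weak_star E => (phi : dual E) x).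
Proof.
move=> phi; have /cvg_sup/(_ x) h : nbhs phi --> (phi : weak_star E) by [].
have c : continuous_at (phi : initial_topology (fun phi : dual E => phi x))
  (fun phi : dual E => phi x) by exact: initial_continuous.
exact: (cvg_trans (cvg_app (fun phi : dual E => phi x) h) c).
Qed.

Lemma weak_star_cvg (F : set_system (weak_star E)) (phi : weak_star E) :
  Filter F -> (forall x, (psi : dual E) x @[psi --> F] --> (phi : dual E) x) ->
  F --> phi.
Proof.
move=> FF h; apply/cvg_sup => x A /= [B [[C oC <-] Cphi] BA].
apply: (@filterS _ F _ _ _ BA); apply: (h x); exact: open_nbhs_nbhs.
Qed.

Definition dual_ball (rho : R) : set (weak_star E) := [set phi | `|phi : dual E| <= rho].

Lemma dual_norm_leP (phi : dual E) (rho : R) : 0 <= rho ->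
  `|phi| <= rho <-> forall x, `|phi x| <= rho * `|x|.
Proof.
move=> rho0; split=> [h x|h].
  by apply: le_trans (dual_bound phi x) _; rewrite ler_wpM2r.
by apply: dual_norm_le => x x1; apply: le_trans (h x) _; rewrite ler_piMr.
Qed.

(** An ultrafilter on the ball converges pointwise, by compactness of
intervals, and the pointwise limit is again linear and bounded by [rho]. *)
Lemma banach_alaoglu (rho : R) : compact (dual_ball rho).
Proof.
have [rho0|rho0] := leP 0 rho; last first.
  rewrite (_ : dual_ball rho = set0); first exact: compact0.
  rewrite -subset0 => phi /=; rewrite /dual_ball/= => h.
  by move: rho0; rewrite ltNge => /negP; apply; exact: le_trans h.
rewrite compact_ultra => F FU FK.
have lim x : exists l : R, (psi : dual E) x @[psi --> F] --> l.
  have [l [_ lcl]] : `[- (rho * `|x|), rho * `|x|] `&`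
      cluster ((fun psi : weak_star E => (psi : dual E) x) @ F) !=set0.
    apply: segment_compact; rewrite /nbhs/=.
    apply: filterS FK => phi /(dual_norm_leP _ rho0)/(_ x).
    by rewrite ler_norml /= in_itv/=.
  exists l; move=> B Bl; rewrite /nbhs/=.
  have [//|FB] := in_ultra_setVsetC ((fun psi : weak_star E => (psi : dual E) x) @^-1` B) FU.
  have [y [/= nBy]] := lcl (~` B) B FB Bl.
  by [].
have [l lP] := choice lim.
have nearE x e : 0 < e -> F [set psi | `|l x - (psi : dual E) x| < e].
  by move=> e0; have /cvgrPdist_lt/(_ _ e0) := lP x.
have linl : linear (l : E -> R^o).
  move=> c x y;  apply: (cvg_unique (@norm_hausdorff _ R^o) (lP (c *: x + y))).
  rewrite (_ : (fun psi : weak_star E => (psi : dual E) (c *: x + y)) =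
    (fun psi : weak_star E => c *: ((psi : dual E) x : R^o) + (psi : dual E) y)).
    by apply: cvgD; [apply: cvgZr; exact: lP|exact: lP].
  by apply/funext => psi; exact: (linearP (psi : dual E)).
have lb x : l x <= rho * `|x|.
  apply/ler_addgt0Pr => e e0; have [psi [/= h1 h2]] := filter_ex (filterI FK (nearE x e e0)).
  have /(_ x) := (dual_norm_leP psi rho0).1 h1.
  by move: h2; rewrite !ltr_norml ler_norml; lra.
have [phi phiE] := dual_of_bounded linl lb.
exists phi; split.
  apply/dual_norm_leP => // x; rewrite phiE ler_norml lb andbT lerNl.
  by have := lb (- x); rewrite -!phiE linearN normrN.
by apply: weak_star_cvg => x; rewrite phiE.
Qed.

Lemma weak_star_closed_le (x : E) (c : R) :
  closed [set phi : weak_star E | (phi : dual E) x <= c].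
Proof.
by apply: (closed_comp _ (@closed_le _ c)) => phi _; exact: weak_star_eval_continuous.
Qed.

Lemma weak_star_closed_ge (x : E) (c : R) :
  closed [set phi : weak_star E | c <= (phi : dual E) x].
Proof.
by apply: (closed_comp _ (@closed_ge _ c)) => phi _; exact: weak_star_eval_continuous.
Qed.

Lemma weak_star_open_lt (x : E) (c : R) :
  open [set phi : weak_star E | (phi : dual E) x < c].
Proof.
apply: (@open_comp _ _ (fun phi : weak_star E => (phi : dual E) x)
  [set y : R | y < c] _ (@open_lt _ c)).
by move=> phi _; exact: weak_star_eval_continuous.
Qed.

Lemma weak_star_open_gt (x : E) (c : R) :
  open [set phi : weak_star E | c < (phi : dual E) x].
Proof.
apply: (@open_comp _ _ (fun phi : weak_star E => (phi : dual E) x)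
  [set y : R | c < y] _ (@open_gt _ c)).
by move=> phi _; exact: weak_star_eval_continuous.
Qed.

Lemma dual_ball_closed rho : closed (dual_ball rho).
Proof.
have [rho0|rho0] := leP 0 rho; last first.
  rewrite (_ : dual_ball rho = set0); first exact: closed0.
  rewrite -subset0 => phi /=; rewrite /dual_ball/= => h.
  by move: rho0; rewrite ltNge => /negP; apply; exact: le_trans h.
rewrite (_ : dual_ball rho = \bigcap_(x in [set: E])
  [set phi : weak_star E | (phi : dual E) x <= rho * `|x|]).
  by apply: closed_bigI => x _; exact: weak_star_closed_le.
apply/seteqP; split=> phi.
  by move=> /(dual_norm_leP _ rho0) h x _; apply: le_trans (ler_norm _) (h x).
move=> h; apply/(dual_norm_leP _ rho0) => x; rewrite ler_norml lerNl.
rewrite (h x I) andbT; have := h (- x) I.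
by rewrite /= linearN normrN.
Qed.

End WeakStar.

Section WeakStarBase.
Context {R : realType} {E : normedModType R}.

Lemma separable_sequence : separable E ->
  exists d : nat -> E, forall x e, 0 < e -> exists i, `|x - d i| < e.
Proof.
move=> [D /countable_injP[h] hinj dD].
exists (fun i => xget 0 [set x | D x /\ h x = i]) => x e e0.
have [y [xy Dy]] : ball x e `&` D !=set0.
  by apply: dD; [exists x; exact: ballxx|exact: ball_open].
exists (h y); rewrite -ball_normE in xy.
have [Dz hz] : [set z | D z /\ h z = h y] (xget 0 [set z | D z /\ h z = h y]).
  by apply: (@xgetPex _ 0 [set z | D z /\ h z = h y]); exists y.
rewrite (hinj _ _ _ _ hz) ?inE//.
Qed.

Variable d : nat -> E.
Hypothesis d_dense : forall x e, 0 < e -> exists i, `|x - d i| < e.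

(** Boxes given by points of the dense sequence and rational bounds. Their
codes form a countable type, and the closed and the open box of a code are
used together to be able to cover by closed sets. *)
Definition box_code := seq (nat * rat * rat).

Definition open_box (c : box_code) : set (weak_star E) :=
  [set phi | forall z, z \in c -> ratr z.1.2 < (phi : dual E) (d z.1.1) < ratr z.2].

Definition closed_box (c : box_code) : set (weak_star E) :=
  [set phi | forall z, z \in c -> ratr z.1.2 <= (phi : dual E) (d z.1.1) <= ratr z.2].

Lemma open_box_sub c : open_box c `<=` closed_box c.
Proof. by move=> phi h z /h /andP[? ?]; rewrite !ltW. Qed.

Lemma open_box_open c : open (open_box c).
Proof.
elim: c => [|z c IH].
  by rewrite (_ : open_box [::] = setT); [exact: openT|apply/seteqP; split].
rewrite (_ : open_box (z :: c) = ([set phi : weak_star E | ratr z.1.2 < (phi : dual E) (d z.1.1)]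
    `&` [set phi : weak_star E | (phi : dual E) (d z.1.1) < ratr z.2]) `&` open_box c).
  apply: openI IH; apply: openI; [exact: weak_star_open_gt|exact: weak_star_open_lt].
apply/seteqP; split=> phi.
  move=> h; split; last by move=> w wc; apply: h; rewrite inE wc orbT.
  by have /andP[] := h z (mem_head _ _).
by move=> [[h1 h2] h] w; rewrite inE => /orP[/eqP ->|/h//]; apply/andP.
Qed.

Lemma closed_box_closed c : closed (closed_box c).
Proof.
elim: c => [|z c IH].
  by rewrite (_ : closed_box [::] = setT); [exact: closedT|apply/seteqP; split].
rewrite (_ : closed_box (z :: c) = ([set phi : weak_star E | ratr z.1.2 <= (phi : dual E) (d z.1.1)]
    `&` [set phi : weak_star E | (phi : dual E) (d z.1.1) <= ratr z.2]) `&` closed_box c).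
  apply: closedI IH; apply: closedI; [exact: weak_star_closed_ge|exact: weak_star_closed_le].
apply/seteqP; split=> phi.
  move=> h; split; last by move=> w wc; apply: h; rewrite inE wc orbT.
  by have /andP[] := h z (mem_head _ _).
by move=> [[h1 h2] h] w; rewrite inE => /orP[/eqP ->|/h//]; apply/andP.
Qed.

(** On a ball, the values at the dense sequence control the values everywhere;
so the filter generated by the traces of the boxes containing [phi] in their
interior converges to [phi], i.e. it is finer than the neighbourhood filter.
*)
Lemma box_base rho (phi : weak_star E) (U : set (weak_star E)) :
  dual_ball rho phi -> nbhs phi U ->
  exists2 c, open_box c phi & closed_box c `&` dual_ball rho `<=` U.
Proof.
move=> phiK.
have rho0 : 0 <= rho by apply: le_trans phiK.
pose G := filter_from [set c | open_box c phi] (fun c => closed_box c `&` dual_ball rho).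
have FG : Filter G.
  apply: filter_from_filter; first by exists [::].
  move=> c c' cphi c'phi; exists (c ++ c').
    by move=> z; rewrite mem_cat => /orP[/cphi|/c'phi].
  move=> psi [h hK]; split; split=> // z zc; apply: h; rewrite mem_cat zc ?orbT//.
suff : G --> phi by move=> /[apply].
apply: weak_star_cvg => x; apply/cvgrPdist_lt => e e0.
have e1 : 0 < e / (4 * (rho + 1)) by rewrite divr_gt0// mulr_gt0// ltr_wpDl.
have [i xi] := d_dense x e1.
pose y : R := (phi : dual E) (d i).
have [p pI] := @rat_in_itvoo R (y - e / 4) y ltac:(lra).
have [q qI] := @rat_in_itvoo R y (y + e / 4) ltac:(lra).
move: pI qI; rewrite !in_itv/= => /andP[p1 p2] /andP[q1 q2].
exists [:: (i, p, q)].
  by move=> z; rewrite inE => /eqP -> /=; rewrite p2 q1.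
move=> psi [/(_ _ (mem_head _ _))/= /andP[h1 h2] psiK].
have bnd (f : dual E) : `|f| <= rho -> `|f (x - d i)| <= e / 4.
  move=> fK; apply: le_trans ((dual_norm_leP f rho0).1 fK _) _.
  have : rho * `|x - d i| <= (rho + 1) * `|x - d i| by rewrite ler_wpM2r//; lra.
  move: xi; rewrite ltr_pdivlMr ?mulr_gt0 ?ltr_wpDl// => xi.
  by have := normr_ge0 (x - d i); nra.
have := bnd _ phiK; have := bnd _ psiK; rewrite !linearB/= !ler_norml ltr_norml.
by rewrite -/y; lra.
Qed.

End WeakStarBase.

(** * One-sided approximation on weak* compact sets *)

Section MeanFacts.
Context {R : realType} {T : Type} {A : set T} {L : (T -> R) -> R}.
Hypothesis meanL : mean A L.

Lemma mean_cst c : L (fun=> c) = c.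
Proof.
rewrite (_ : (fun=> c) = c *: (fun=> 1 : R)).
  by rewrite (meanZ meanL) ?(mean1 meanL) ?mulr1//; exact: bounded_on_cst.
by apply/funext => t; rewrite fctE /GRing.scale/= mulr1.
Qed.

Lemma mean_ge0 u : bounded_on A u -> (forall t, A t -> 0 <= u t) -> 0 <= L u.
Proof.
move=> bu u0; rewrite -(mean_cst 0).
by apply: (mean_le meanL) => //; exact: bounded_on_cst.
Qed.

(** The Cauchy-Schwarz inequality for the mean weighted by [u], in the form of
the positivity of [L (u * (s - t) ^+ 2)]. *)
Lemma mean_discriminant u s t : bounded_on A u -> (forall x, A x -> 0 <= u x) ->
  bounded_on A s -> 2 * t * L (u * s) <= L (u * (s * s)) + t ^+ 2 * L u.
Proof.
move=> bu u0 bs.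
have bus := bounded_onM bu bs; have buss := bounded_onM bu (bounded_onM bs bs).
have bZ c v : bounded_on A v -> bounded_on A (c *: v).
  move=> bv; rewrite (_ : c *: v = (fun=> c) * v)//.
  by apply: bounded_onM => //; exact: bounded_on_cst.
rewrite -(meanZ meanL (2 * t))// -(meanZ meanL (t ^+ 2))// -(meanD meanL) //; last exact: bZ.
apply: (mean_le meanL); [exact: bZ|by apply: bounded_onD => //; exact: bZ|].
move=> x Ax; rewrite !fctE /GRing.scale/=.
by have := mulr_ge0 (u0 x Ax) (sqr_ge0 (s x - t)); nra.
Qed.

End MeanFacts.

Section Haydon.
Context {R : realType} {E : completeNormedModType R}.
Implicit Types (X : dual (dual E)) (C : set E).

(** [X] belongs to the closure of [C] for the topology of pointwise
convergence on the dual. *)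
Definition bidual_adherent X C := forall (P : seq (dual E)) e, 0 < e ->
  exists2 x, C x & forall phi, phi \in P -> `|phi x - X phi| < e.

Lemma bidual_adherent_ultra X C : bidual_adherent X C ->
  exists G : set_system E, [/\ UltraFilter G, G C &
    forall (phi : dual E) e, 0 < e -> G [set x | `|phi x - X phi| < e]].
Proof.
move=> XC.
pose B (z : seq (dual E) * R) : set E :=
  C `&` [set x | forall phi, phi \in z.1 -> `|phi x - X phi| < z.2].
pose D : set (seq (dual E) * R) := [set z | 0 < z.2].
have PF : ProperFilter (filter_from D B).
  apply: filter_from_proper.
    apply: filter_from_filter; first by exists ([::], 1); rewrite /D/=.
    move=> [P e] [Q d] /= e0 d0; exists (P ++ Q, Num.min e d).
      by rewrite /D/= lt_min e0 d0.
    move=> x [Cx h]; split; split=> //= phi phiP.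
      by have := h phi; rewrite mem_cat phiP lt_min => /(_ isT)/andP[].
    by have := h phi; rewrite mem_cat phiP orbT lt_min => /(_ isT)/andP[].
  by move=> [P e] /= e0; have [x Cx h] := XC P e e0; exists x.
have [G [UG FG]] := ultraFilterLemma PF; exists G; split=> //.
  by apply: FG; exists ([::], 1); [rewrite /D/=|move=> x []].
move=> phi e e0; apply: FG; exists ([:: phi], e) => // x [_ h].
by apply: h; rewrite mem_head.
Qed.

Variables (X : dual (dual E)) (C : set E) (A : set (weak_star E)) (r rho al d : R).
Hypotheses (no_ell1 : ~ contains_copy_of (ell1 R) E).
Hypotheses (cC : convex_subset C) (Cr : forall x, C x -> `|x| <= r)
  (XC : bidual_adherent X C).
Hypotheses (clA : closed A) (Arho : A `<=` dual_ball rho)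
  (XA : forall phi, A phi -> X phi <= al) (d0 : 0 < d).

(** Argue by contradiction: no point of [C] is strictly below [al + d] on all
of [A]. A mean on [A] then assigns at least [al + d] to every point of [C],
while along an ultrafilter [G] converging to [X] every functional of [A] ends
up below [al + d / 4]. *)
Section contra.
Hypothesis gap : forall y, C y -> exists2 phi, A phi & al + d <= (phi : dual E) y.

Let rho0 : 0 <= rho.
Proof.
have [x Cx _] := XC [::] ltr01; have [phi Aphi _] := gap Cx.
exact: le_trans (Arho Aphi).
Qed.

Let r0 : 0 <= r.
Proof. by have [x Cx _] := XC [::] ltr01; exact: le_trans (Cr Cx). Qed.

Let ev (y : E) : weak_star E -> R := fun phi => (phi : dual E) y.

Let ev_bounded y : bounded_on A (ev y).
Proof. by exists (rho * `|y|) => phi /Arho h; exact: (dual_norm_leP _ rho0).1. Qed.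

Let mean_ex : exists2 L, mean A L & forall y, C y -> al + d <= L (ev y).
Proof.
have [x0 Cx0 _] := XC [::] ltr01; have [phi0 Aphi0 _] := gap Cx0.
have [|||y' [y Cy <-]|y' [y Cy <-]|L mL LY] :=
  @separating_mean R (weak_star E) A [set ev y | y in C] (al + d).
- by exists phi0.
- by exists (ev x0); exists x0.
- move=> _ _ t [y Cy <-] [z Cz <-] t01; exists (t *: y + (1 - t) *: z).
    exact: cC.
  by apply/funext => phi; rewrite /ev linearD !linearZ.
- exact: ev_bounded.
- exact: gap.
- by exists L => // y Cy; apply: LY; exists y.
Qed.

Section rich.
Variables (L : (weak_star E -> R) -> R) (G : set_system E).
Hypotheses (mL : mean A L) (LC : forall y, C y -> al + d <= L (ev y)).
Hypotheses (UG : UltraFilter G) (GC : G C)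
  (GX : forall (phi : dual E) e, 0 < e -> G [set x | `|phi x - X phi| < e]).

Let FG : ProperFilter G := ultra_proper.

Let g := al + d / 2.
(* h y measures the excess of y over the intermediate level g *)
Let h (y : E) : weak_star E -> R := fun phi => Num.max (ev y phi - g) 0.

Let adm (u : weak_star E -> R) :=
  [/\ continuous u, (forall phi, 0 <= u phi) & bounded_on A u].

Let admD u v : adm u -> adm v -> adm (u + v).
Proof.
move=> [cu u0 bu] [cv v0 bv]; split.
- by move=> phi; apply: continuousD; [exact: cu|exact: cv].
- by move=> phi; rewrite fctE addr_ge0.
- exact: bounded_onD.
Qed.

Let admM u v : adm u -> adm v -> adm (u * v).
Proof.
move=> [cu u0 bu] [cv v0 bv]; split.
- by move=> phi; apply: continuousM; [exact: cu|exact: cv].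
- by move=> phi; rewrite fctE mulr_ge0.
- exact: bounded_onM.
Qed.

Let adm_max u : continuous u -> bounded_on A u -> adm (fun phi => Num.max (u phi) 0).
Proof.
move=> cu [M uM]; split.
- by move=> phi; apply: continuous_max; [exact: cu|exact: cst_continuous].
- by move=> phi; rewrite le_max lexx orbT.
- exists M => phi /uM; apply: le_trans; rewrite ger0_norm ?le_max ?lexx ?orbT//.
  by rewrite ge_max normr_ge0 ler_norm.
Qed.

Let adm_h y : adm (h y).
Proof.
apply: adm_max.
  move=> phi; apply: continuousB; last exact: cst_continuous.
  exact: weak_star_eval_continuous.
have [M yM] := ev_bounded y; exists (M + `|g|) => phi /yM yM'.
by apply: le_trans (ler_normB _ _) _; rewrite lerD2r.
Qed.

Let adm_cst c : 0 <= c -> adm (fun=> c).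
Proof. by move=> c0; split=> //; [exact: cst_continuous|exact: bounded_on_cst]. Qed.

(** A weight [u] is rich when the excess of [y] over [g], weighted by [u],
keeps a positive mean along [G]. In terms of measures, the limits of
[L (u * h y)] define a nonzero measure, and [u] is rich when it charges [u].
*)
Let rich u := exists2 e, 0 < e & G [set y | e <= L (u * h y)].

Let notrich u e : ~ rich u -> 0 < e -> G [set y | L (u * h y) < e].
Proof.
move=> nu e0; have [Ge|] := in_ultra_setVsetC [set y | e <= L (u * h y)] UG.
  by exfalso; apply: nu; exists e.
by apply: filterS => y /= /negP; rewrite -ltNge.
Qed.

Let rich_le u v K : adm u -> adm v -> 0 < K ->
  (forall phi, A phi -> u phi <= K * v phi) -> rich u -> rich v.
Proof.
move=> au av K0 uv [e e0 Ge]; exists (e / K); first by rewrite divr_gt0.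
apply: filterS Ge => y /= /le_trans eL; rewrite ler_pdivrMr// mulrC.
have [[_ u0 bu] [_ v0 bv] [_ h0 bh]] := And3 au av (adm_h y).
have bvh := bounded_onM bv bh.
rewrite -(meanZ mL)//; apply: eL; apply: (mean_le mL).
- exact: bounded_onM.
- rewrite (_ : K *: _ = (fun=> K) * (v * h y))//.
  by apply: bounded_onM => //; exact: bounded_on_cst.
- by move=> phi Aphi; rewrite !fctE /GRing.scale/= mulrA ler_wpM2r// uv.
Qed.

(** Along an ultrafilter, if neither [u] nor [v] is rich, then both means are
small for common points [y]. *)
Let richD u v : adm u -> adm v -> rich (u + v) -> rich u \/ rich v.
Proof.
move=> au av [e e0 Ge]; apply: contrapT => /not_orP[nu nv].
have e2 : 0 < e / 2 by rewrite divr_gt0.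
have [y /= [[h1 h2] h3]] :=
  filter_ex (filterI (filterI Ge (notrich nu e2)) (notrich nv e2)).
move: h1; rewrite /= mulrDl (meanD mL).
- by move: h2 h3 => /=; lra.
- by case: (admM au (adm_h y)).
- by case: (admM av (adm_h y)).
Qed.

Let not_rich0 : ~ rich (fun=> 0).
Proof.
move=> [e e0 Ge]; have [y /= hy] := filter_ex Ge.
move: hy; rewrite (_ : (fun=> 0) * h y = (fun=> 0)); last first.
  by apply/funext => phi; rewrite fctE mul0r.
by rewrite (mean_cst mL) => /(lt_le_trans e0); rewrite ltxx.
Qed.

Let rich1 : rich (fun=> 1).
Proof.
exists (d / 2); first by rewrite divr_gt0.
apply: filterS GC => y Cy /=.
have [_ _ b] := admM (adm_cst ler01) (adm_h y).
apply: (@le_trans _ _ (L (ev y + (fun=> - g)))).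
  rewrite (meanD mL) ?(mean_cst mL)//; last exact: bounded_on_cst.
  by have := LC Cy; rewrite /g; lra.
apply: (mean_le mL) => //; first by apply: bounded_onD => //; exact: bounded_on_cst.
by move=> phi _; rewrite !fctE mul1r /h le_max lexx.
Qed.

Let h_le y : C y -> forall phi, A phi -> h y phi <= rho * r + `|g|.
Proof.
move=> Cy phi Aphi; rewrite /h ge_max addr_ge0 ?mulr_ge0// andbT.
apply: lerD; last by rewrite -normrN ler_norm.
apply: le_trans (ler_norm _) _; apply: le_trans ((dual_norm_leP _ rho0).1 (Arho Aphi) y) _.
by rewrite ler_wpM2l// Cr.
Qed.

Let M := rho * r + `|g| + 1.

Let M0 : 0 < M.
Proof. by rewrite ltr_wpDl// addr_ge0// mulr_ge0. Qed.

Let h_leM y : C y -> forall phi, A phi -> h y phi <= M.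
Proof. by move=> Cy phi Aphi; have := h_le Cy Aphi; rewrite /M; lra. Qed.

Let cut (u : weak_star E -> R) e : weak_star E -> R := fun phi => Num.max (u phi - e) 0.

Let adm_cut u e : adm u -> adm (cut u e).
Proof.
move=> [cu _ [N uN]]; apply: adm_max.
  by move=> phi; apply: continuousB; [exact: cu|exact: cst_continuous].
exists (N + `|e|) => phi /uN uN'.
by apply: le_trans (ler_normB _ _) _; rewrite lerD2r.
Qed.

Let rich_cut u : adm u -> rich u -> exists2 e, 0 < e & rich (cut u e).
Proof.
move=> au [e e0 Ge]; exists (e / (2 * M)); first by rewrite divr_gt0// mulr_gt0.
exists (e / 2); first by rewrite divr_gt0.
apply: filterS (filterI GC Ge) => y [Cy /= eL].
have [_ u0 bu] := au; have [_ h0 bh] := adm_h y.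
have [_ c0 bc] := admM (adm_cut (e / (2 * M)) au) (adm_h y).
have : L (u * h y) <= L (cut u (e / (2 * M)) * h y + (fun=> e / 2)).
  apply: (mean_le mL).
  - exact: bounded_onM.
  - by apply: bounded_onD => //; exact: bounded_on_cst.
  move=> phi Aphi; rewrite !fctE.
  have q0 : 0 <= e / (2 * M) by rewrite divr_ge0 ?mulr_ge0 ?ltW.
  have : e / (2 * M) * h y phi <= e / 2.
    rewrite (_ : e / 2 = e / (2 * M) * M); last by field; rewrite gt_eqF.
    by rewrite ler_wpM2l// h_leM.
  have : u phi * h y phi <= (cut u (e / (2 * M)) phi + e / (2 * M)) * h y phi.
    by rewrite ler_wpM2r// -lerBlDr /cut le_max lexx.
  by rewrite mulrDl; lra.
rewrite (meanD mL)//; last exact: bounded_on_cst.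
by rewrite (mean_cst mL); lra.
Qed.

(** A point of the support of the limit measure where [u] does not vanish: by
compactness it is a cluster point of the sets where [u >= e] and where
finitely many poor weights are small. *)
Let rich_support u : adm u -> rich u -> exists phi, [/\ A phi, 0 < u phi &
  forall v, adm v -> 0 < v phi -> rich v].
Proof.
move=> au ru; have [e e0 rc] := rich_cut au ru.
pose S (z : (weak_star E -> R) * R) : set (weak_star E) :=
  A `&` ([set phi | e <= u phi] `&` [set phi | z.1 phi <= z.2]).
pose D : set ((weak_star E -> R) * R) := [set z | [/\ adm z.1, ~ rich z.1 & 0 < z.2]].
have D0 : D (fun=> 0, 1) by split=> //; exact: adm_cst.
have PF : ProperFilter (filter_from D S).
  apply: filter_from_proper.
    apply: filter_from_filter; first by exists (fun=> 0, 1).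
    move=> [v k] [w l] /= [av nv k0] [aw nw l0]; exists (v + w, Num.min k l).
      split=> /=; [exact: admD| |by rewrite lt_min k0].
      by move/(richD av aw) => [].
    have [_ v0 _] := av; have [_ w0 _] := aw.
    move=> phi [Aphi [ephi /=]]; rewrite fctE le_min => /andP[hk hl].
    split; split=> //; split=> //=; have /= := v0 phi; have /= := w0 phi; move: hk hl; lra.
  move=> [v k] /= [av nv k0]; apply: contrapT => noS; apply: nv.
  have [_ v0 _] := av; have [_ u0 [N uN]] := au.
  have N0 : 0 < `|N| + 1 by rewrite ltr_wpDl.
  apply: (@rich_le (cut u e) v ((`|N| + 1) / k)) => //; first exact: adm_cut.
    by rewrite divr_gt0.
  move=> phi Aphi; rewrite /cut ge_max; apply/andP; split; last first.
    by rewrite mulr_ge0// divr_ge0// ltW.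
  have [ephi|/ltW ephi] := leP e (u phi); last first.
    by apply: (@le_trans _ _ 0); [rewrite subr_le0|rewrite mulr_ge0// divr_ge0// ltW].
  have [vk|vk] := leP (v phi) k; first by exfalso; apply: noS; exists phi.
  apply: (@le_trans _ _ (`|N| + 1)).
    by have := uN _ Aphi; have := ler_norm (u phi); have := ler_norm N; lra.
  by rewrite -mulrA ler_peMr ?(ltW N0)// mulrC ler_pdivlMr// mul1r ltW.
have cA : compact A by exact: subclosed_compact clA (@banach_alaoglu _ _ rho) Arho.
have [phi [Aphi]] : A `&` cluster (filter_from D S) !=set0.
  by apply: cA; exists (fun=> 0, 1) => // phi [].
rewrite clusterE => cl.
have Sphi v k : adm v -> ~ rich v -> 0 < k -> S (v, k) phi.
  move=> av nv k0.
  have clS : closed (S (v, k)).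
    have [cu _ _] := au; have [cv _ _] := av.
    apply: closedI => //; apply: closedI.
      exact: (closed_comp (fun phi _ => cu phi) (@closed_ge _ e)).
    exact: (closed_comp (fun phi _ => cv phi) (@closed_le _ k)).
  by rewrite [X in X phi](closure_id _).1//; apply: cl; exists (v, k).
exists phi; split=> //.
  by have [_ [/= + _]] := Sphi _ _ (adm_cst (lexx 0)) not_rich0 ltr01; apply: lt_le_trans.
move=> v av v0; apply: contrapT => nv.
have v2 : 0 < v phi / 2 by rewrite divr_gt0.
have [_ [_ /=]] := Sphi _ _ av nv v2.
by lra.
Qed.

(** In the language of measures, [h y] converges weakly to a density [theta],
and [u] is rich when [u * theta] has positive integral; then so has
[u * theta ^+ 2], the limit of the integrals of [u * theta * h y]. Concretely,
if [u * h y] were poor along [G], one could choose points [y 1], ..., [y n]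
along [G] that are almost orthogonal for the mean weighted by [u]. The sum [s]
of the [h (y i)] would have a mean of order [n] and a mean square of order [n]
too, against Cauchy-Schwarz. *)
Let rich_mul_h u : adm u -> rich u -> G [set y | rich (u * h y)].
Proof.
move=> au [e e0 Ge].
have [//|Gn] := in_ultra_setVsetC [set y | rich (u * h y)] UG.
exfalso.
have [_ u0 bu] := au.
pose B := M ^+ 2 * L u + 2.
have Lu0 : 0 <= L u := mean_ge0 mL bu (fun x _ => u0 x).
have B0 : 0 < B by rewrite ltr_wpDl// mulr_ge0// sqr_ge0.
have step (n : nat) : exists s, [/\ adm s, ~ rich (u * s),
    n%:R * e <= L (u * s) & L (u * (s * s)) <= n%:R * B].
  elim: n => [|n [s [as_ ns Ls Lss]]].
    exists (fun=> 0).
    have u0E : u * (fun=> 0) = (fun=> 0) by apply/funext => phi; rewrite fctE mulr0.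
    have z0 : (fun=> 0) * (fun=> 0) = (fun=> 0) :> (weak_star E -> R).
      by apply/funext => phi; rewrite fctE mulr0.
    rewrite z0 u0E (mean_cst mL) !mul0r; split=> //; exact: adm_cst.
  have [y [[Cy eL] [nr sm]]] := filter_ex (filterI (filterI GC Ge)
    (filterI Gn (notrich ns ltr01))).
  have ah := adm_h y; have [_ _ bh] := ah; have [_ s0 bs] := as_.
  exists (s + h y); split; first exact: admD.
  - by rewrite mulrDr => /(richD (admM au as_) (admM au ah))[].
  - rewrite mulrDr (meanD mL); [|exact: bounded_onM|exact: bounded_onM].
    by move: eL; rewrite /= -natr1 mulrDl mul1r; lra.
  - have -> : u * ((s + h y) * (s + h y)) = (u * (s * s) + u * (h y * h y)) +
        (u * s * h y + u * s * h y).
      by apply/funext => phi; rewrite !fctE; ring.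
    have b1 := bounded_onM bu (bounded_onM bs bs).
    have b2 := bounded_onM bu (bounded_onM bh bh).
    have b3 := bounded_onM (bounded_onM bu bs) bh.
    rewrite !(meanD mL)//; try by [exact: bounded_onD].
    have bMu : bounded_on A (M ^+ 2 *: u).
      rewrite (_ : _ *: u = (fun=> M ^+ 2) * u)//.
      by apply: bounded_onM => //; exact: bounded_on_cst.
    have : L (u * (h y * h y)) <= M ^+ 2 * L u.
      rewrite -(meanZ mL)//; apply: (mean_le mL) => // phi Aphi.
      rewrite !fctE /GRing.scale/= mulrC ler_wpM2r// expr2.
      have [_ h0 _] := ah.
      by rewrite ler_pM// h_leM.
    have -> : M ^+ 2 * L u = B - 2 by rewrite /B addrK.
    by move: sm; rewrite /= -[n.+1%:R]natr1 mulrDl mul1r; lra.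
(* the value of t that makes the linear term twice as large as n * B *)
pose t := B / e.
have t0 : 0 <= t by rewrite divr_ge0// ltW.
pose n := (Num.truncn (t ^+ 2 * L u / B)).+1.
have nB : t ^+ 2 * L u < n%:R * B by rewrite -ltr_pdivrMr// truncnS_gt.
have [s [[_ s0 bs] _ Ls Lss]] := step n.
have := mean_discriminant mL t bu (fun x _ => u0 x) bs.
have : t * (n%:R * e) <= t * L (u * s) by rewrite ler_wpM2l.
have -> : t * (n%:R * e) = n%:R * B by rewrite /t; field; rewrite gt_eqF.
by lra.
Qed.

(** The family to be split: subsets of [A] that contain the points of [A]
where some rich weight is positive. The upper part of a cut stays rich by
[rich_mul_h]; the lower part stays rich because it contains a point of the
support, at which [y] is close to [X], hence below [al + d / 4]. *)
Let RR (W : set (dual E)) := (W `<=` (A : set (dual E))) /\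
  exists u, [/\ adm u, rich u & forall phi, A phi -> 0 < u phi -> W phi].

Lemma mean_gap_absurd : False.
Proof.
apply: no_ell1.
have ab : al + d / 4 < g by rewrite /g; move: d0; lra.
have rho1 : 0 < rho + 1 by rewrite ltr_wpDl.
apply: (@ell1_copy_of_tree _ _ RR r (rho + 1) _ _ ab rho1).
- by exists A; split=> //; exists (fun=> 1); split=> //; exact: adm_cst.
- move=> W [_ [u [au ru uW]]]; have [phi [Aphi u0 _]] := rich_support au ru.
  by exists phi; exact: uW.
- move=> W [WA _] phi /WA/Arho h1; apply: le_trans h1 _; lra.
move=> I U RU.
have /choice[u uP] : forall i, exists u, [/\ adm u, rich u &
    forall phi, A phi -> 0 < u phi -> U i phi] by move=> i; case: (RU i).
have /choice[p pP] : forall i, exists p, [/\ A p, 0 < u i p &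
    forall v, adm v -> 0 < v p -> rich v].
  by move=> i; have [au ru _] := uP i; exact: rich_support.
have d4 : 0 < d / 4 by rewrite divr_gt0.
pose near_p i : set E := [set y | `|(p i : dual E) y - X (p i)| < d / 4 /\ rich (u i * h y)].
have G1 i : G (near_p i).
  by have [au ru _] := uP i; apply: filterI; [exact: GX|exact: rich_mul_h].
have [y [Cy yP]] := filter_ex (filterI GC (@filter_forall _ _ near_p G _ G1)).
exists y; first exact: Cr.
move=> i; have [UA _] := RU i; have [au ru uU] := uP i.
have [Ap up pr] := pP i; have [yX ry] := yP i.
split; split.
- by move=> phi [/UA].
- pose v : weak_star E -> R := fun phi => Num.max (al + d / 4 - ev y phi) 0.
  have av : adm v.
    apply: adm_max.
      move=> phi; apply: (@continuousB _ _ _ (fun=> al + d / 4) (ev y)).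
        exact: cst_continuous.
      exact: weak_star_eval_continuous.
    have [N yN] := ev_bounded y; exists (`|al + d / 4| + N) => phi /yN yN'.
    by apply: le_trans (ler_normB _ _) _; rewrite lerD2l.
  have [_ u0 _] := au; have [_ v0 _] := av.
  exists (u i * v); split; first exact: admM.
    apply: pr; first exact: admM.
    rewrite fctE mulr_gt0// /v lt_max subr_gt0; apply/orP; left.
    by have := XA Ap; move: yX; rewrite ltr_norml /ev => /andP[_]; lra.
  move=> phi Aphi; rewrite fctE => uv0.
  have up0 : 0 < u i phi.
    by rewrite lt_def u0 andbT; apply: contraTneq uv0 => ->; rewrite mul0r ltxx.
  split; first exact: uU.
  by move: uv0; rewrite pmulr_rgt0// /v lt_max ltxx orbF subr_gt0.
- by move=> phi [/UA].
- exists (u i * h y); split=> //; first exact: admM.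
  have [_ u0 _] := au; have [_ h0 _] := adm_h y.
  move=> phi Aphi; rewrite fctE => uv0.
  have up0 : 0 < u i phi.
    by rewrite lt_def u0 andbT; apply: contraTneq uv0 => ->; rewrite mul0r ltxx.
  split; first exact: uU.
  by move: uv0; rewrite pmulr_rgt0// /h lt_max ltxx orbF subr_gt0.
Qed.

End rich.

Lemma uniform_gap_absurd : False.
Proof.
have [L mL LC] := mean_ex; have [G [UG GC GX]] := bidual_adherent_ultra XC.
exact: mean_gap_absurd mL LC UG GC GX.
Qed.

End contra.

(** Without copies of [l^1], the pointwise bound [X <= al] on [A] also holds
for the functionals represented by means on [A]; by Hahn-Banach this is the
same as the existence of a uniform approximation from above. *)
Lemma haydon_separation :
  exists2 y, C y & forall phi, A phi -> (phi : dual E) y <= al + d.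
Proof.
apply: contrapT => no_y; apply: uniform_gap_absurd => y Cy; apply: contrapT => no_phi.
apply: no_y; exists y => // phi Aphi; rewrite leNgt; apply/negP => /ltW h.
by apply: no_phi; exists phi.
Qed.

End Haydon.

(** * Covering the dual by sets of small one-sided oscillation *)

Section Fragment.
Context {R : realType} {E : completeNormedModType R}.
Hypothesis no_ell1 : ~ contains_copy_of (ell1 R) E.
Variables (X : dual (dual E)) (rho : R).
Hypothesis rho0 : 0 < rho.

(** Otherwise both [X <= a] and [X >= b] hold on dense subsets of [S]; then
the relatively open nonempty subsets of [S] form a splitting family,
Goldstine's theorem providing the point of [E] that imitates [X] at one chosen
functional of each kind in every set. *)
Lemma locally_one_sided (S : set (weak_star E)) (a b : R) : a < b ->
  S !=set0 -> S `<=` dual_ball rho ->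
  exists W : set (weak_star E), [/\ open W, W `&` S !=set0 &
    (forall phi, W phi -> S phi -> a < X phi) \/
    (forall phi, W phi -> S phi -> X phi < b)].
Proof.
move=> ab S0 Srho; apply: contrapT => noW; apply: no_ell1.
pose e := (b - a) / 3.
have e0 : 0 < e by rewrite divr_gt0 ?subr_gt0.
have dense W : open W -> W `&` S !=set0 ->
    (exists2 phi, (W `&` S) phi & X phi <= a) /\
    (exists2 phi, (W `&` S) phi & b <= X phi).
  move=> oW WS; split; apply: contrapT => no; apply: noW; exists W; split=> //.
    left=> phi Wphi Sphi; rewrite ltNge; apply/negP => h.
    by apply: no; exists phi.
  right=> phi Wphi Sphi; rewrite ltNge; apply/negP => h.
  by apply: no; exists phi.
pose RR (U : set (dual E)) := exists W : set (weak_star E),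
  [/\ open W, W `&` S !=set0 & U = W `&` S].
have ae : a + e < b - e by rewrite /e; lra.
apply: (@ell1_copy_of_tree _ _ RR `|X| rho _ _ ae rho0).
- by exists S, setT; rewrite setTI; split=> //; exact: openT.
- by move=> _ [W [_ WS ->]].
- by move=> _ [W [_ _ ->]] phi [_ /Srho].
move=> I U RU.
have /choice[W WP] : forall i, exists W : set (weak_star E),
  [/\ open W, W `&` S !=set0 & U i = W `&` S] by [].
have /choice[p pP] : forall i, exists phi : dual E, (W i `&` S) phi /\ X phi <= a.
  by move=> i; have [oW WS _] := WP i; have [[phi ? ?] _] := dense _ oW WS; exists phi.
have /choice[q qP] : forall i, exists phi : dual E, (W i `&` S) phi /\ b <= X phi.
  by move=> i; have [oW WS _] := WP i; have [_ [phi ? ?]] := dense _ oW WS; exists phi.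
have [x xX xP] := @goldstine _ _ X `|X| (map p (enum I) ++ map q (enum I)) e (lexx _) e0.
exists x => // i; have [oW WS UE] := WP i.
have [[Wp Sp] ap] := pP i; have [[Wq Sq] bq] := qP i.
have xp : `|p i x - X (p i)| < e.
  by apply: xP; rewrite mem_cat map_f// mem_enum.
have xq : `|q i x - X (q i)| < e.
  by apply: xP; rewrite mem_cat [X in _ || X]map_f ?orbT// mem_enum.
split.
- exists (W i `&` [set phi : weak_star E | (phi : dual E) x < a + e]); split.
  + by apply: openI => //; exact: weak_star_open_lt.
  + exists (p i); split=> //; split=> //=.
    by move: xp; rewrite ltr_norml => /andP[_]; lra.
  + by rewrite UE setIAC.
- exists (W i `&` [set phi : weak_star E | b - e < (phi : dual E) x]); split.
  + by apply: openI => //; exact: weak_star_open_gt.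
  + exists (q i); split=> //; split=> //=.
    by move: xq; rewrite ltr_norml => /andP[+ _]; lra.
  + by rewrite UE setIAC.
Qed.

Hypothesis sepE : separable E.

(** Say that a set is good when its part with [X <= a] can be covered by
countably many closed sets on which [X <= b]. The union [V] of the open boxes
whose closed box is good is good by countability. If [V] does not contain the
whole ball, the rest [S] of the ball has a relatively open piece, inside a
box, on which [X] is above [a] or below [b]; then that box is good although it
meets the complement of [V]. *)
Lemma countable_cover_level (a b : R) : a < b ->
  exists F : nat -> set (weak_star E),
    (forall n, closed (F n) /\ F n `<=` dual_ball rho `&` [set phi | X phi <= b]) /\
    dual_ball rho `&` [set phi | X phi <= a] `<=` \bigcup_n F n.
Proof.
move=> ab; have [d d_dense] := separable_sequence sepE.
pose ok (F : set (weak_star E)) :=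
  closed F /\ F `<=` dual_ball rho `&` [set phi | X phi <= b].
pose good (S : set (weak_star E)) := exists F : nat -> set (weak_star E),
  (forall n, ok (F n)) /\
  S `&` (dual_ball rho `&` [set phi | X phi <= a]) `<=` \bigcup_n F n.
suff : good setT.
  by move=> [F [okF FS]]; exists F; split=> //; rewrite -[X in X `<=` _]setTI.
have ok0 : ok set0 by split; [exact: closed0|].
pose V := \bigcup_(c in [set c | good (closed_box d c)]) open_box d c.
have goodV : good V.
  have /choice[FF FFP] : forall c, exists F : nat -> set (weak_star E),
      (forall n, ok (F n)) /\ (good (closed_box d c) ->
      closed_box d c `&` (dual_ball rho `&` [set phi | X phi <= a]) `<=` \bigcup_n F n).
    move=> c; have [[F [h1 h2]]|ng] := pselect (good (closed_box d c)).
      by exists F.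
    by exists (fun=> set0); split.
  exists (fun n => if unpickle n is Some z then FF z.1 z.2 else set0); split.
    by move=> n; case: (unpickle n) => // z; case: (FFP z.1).
  move=> phi [[c /= gc cphi] Kphi].
  have [n _ Fphi] := (FFP c).2 gc phi (conj (open_box_sub cphi) Kphi).
  by exists (pickle (c, n)) => //; rewrite pickleK.
have [/seteqP[_ VT]|VT] := eqVneq V setT.
  have [F [h1 h2]] := goodV; exists F; split=> // phi [_ Kphi].
  by apply: h2; split=> //; exact: VT.
pose S := dual_ball rho `&` ~` V.
have oV : open V by apply: bigcup_open => c _; exact: open_box_open.
have [S0|S0] := pselect (S !=set0); last first.
  have [F [h1 h2]] := goodV; exists F; split=> // phi [_ Kphi].
  apply: h2; split=> //; apply: contrapT => nV; apply: S0; exists phi.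
  by split=> //; case: Kphi.
exfalso.
have [W [oW [phi [Wphi Sphi]] WP]] := locally_one_sided ab S0 (@subIsetl _ _ _).
have [phiK nVphi] := Sphi.
have [c ocphi cW] := box_base d_dense phiK (open_nbhs_nbhs (conj oW Wphi)).
apply: nVphi; exists c => //=.
have [F [h1 h2]] := goodV.
have clS : closed S by apply: closedI; [exact: dual_ball_closed|exact: open_closedC].
(* the piece cut out by the box, to be added to the cover of V if X < b there;
   in the other case it contains no functional with X <= a *)
pose F0 := [set psi | X psi <= b /\ (closed_box d c `&` S) psi /\
   forall psi, W psi -> S psi -> X psi < b].
have okF0 : ok F0.
  have [WP2|WP2] := pselect (forall psi, W psi -> S psi -> X psi < b); last first.
    by rewrite (_ : F0 = set0)// -subset0 => psi [_ []].
  have -> : F0 = closed_box d c `&` S.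
    apply/seteqP; split=> psi; first by move=> [_ []].
    move=> [cpsi Spsi]; split=> //; apply/ltW; apply: WP2 => //.
    by apply: cW; split=> //; case: Spsi.
  split; first by apply: closedI => //; exact: closed_box_closed.
  move=> psi [cpsi Spsi]; have [Kpsi _] := Spsi; split=> //=.
  by apply/ltW; apply: WP2 => //; apply: cW.
exists (fun n => if n is m.+1 then F m else F0); split; first by case.
move=> psi [cpsi [Kpsi /= apsi]].
have [Vpsi|nVpsi] := pselect (V psi).
  have [n _ Fn] := h2 psi (conj Vpsi (conj Kpsi apsi)).
  by exists n.+1.
have Spsi : S psi by [].
have Wpsi : W psi by apply: cW.
case: WP => [aX|Xb].
  by exfalso; have := aX _ Wpsi Spsi; rewrite ltNge apsi.
by exists 0 => //; split=> //; exact/ltW/Xb.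
Qed.

End Fragment.

Section Cover.
Context {R : realType} {E : completeNormedModType R}.
Hypothesis no_ell1 : ~ contains_copy_of (ell1 R) E.
Hypothesis sepE : separable E.

(** Use the levels [j * (d / 2)] with [j] an integer, on the balls of integer
radius; the level next above [X phi] costs at most [d / 2], and passing from a
level to the following one in the cover costs [d / 2] more. *)
Lemma countable_cover (X : dual (dual E)) (d : R) : 0 < d ->
  exists (F : nat -> set (weak_star E)) (al rho : nat -> R),
    (forall n, [/\ closed (F n), F n `<=` dual_ball (rho n) &
      forall phi, F n phi -> X phi <= al n]) /\
    (forall phi : weak_star E, exists2 n, F n phi & al n <= X phi + d).
Proof.
move=> d0.
have /choice[FF FFP] : forall z : nat * int, exists F : nat -> set (weak_star E),
    (forall n, closed (F n) /\ F n `<=` dual_ball z.1.+1%:R `&`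
       [set phi | X phi <= (z.2%:~R + 1) * (d / 2)]) /\
    dual_ball z.1.+1%:R `&` [set phi | X phi <= z.2%:~R * (d / 2)] `<=` \bigcup_n F n.
  move=> z; apply: countable_cover_level => //.
  by rewrite mulrDl mul1r ltrDl divr_gt0.
pose code n : option (nat * int * nat) := unpickle n.
exists (fun n => if code n is Some z then FF z.1 z.2 else set0).
exists (fun n => if code n is Some z then (z.1.2%:~R + 1) * (d / 2) else 0).
exists (fun n => if code n is Some z then z.1.1.+1%:R else 0).
split=> [n|phi].
  case: (code n) => [z|]; last by split=> //; exact: closed0.
  have [h _] := FFP z.1; have [h1 h2] := h z.2; split=> // psi Fpsi.
    by have [] := h2 _ Fpsi.
  by have [_] := h2 _ Fpsi.
pose i := Num.truncn `|phi : dual E|.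
pose j := Num.ceil (X phi / (d / 2)).
have d2 : 0 < d / 2 by rewrite divr_gt0.
have [_ h] := FFP (i, j).
have [m _ Fphi] : (\bigcup_n FF (i, j) n) phi.
  apply: h; split=> /=; first exact/ltW/truncnS_gt.
  by rewrite -ler_pdivrMr// ceil_ge.
exists (pickle ((i, j), m)); rewrite /code pickleK//=.
have : (j - 1)%:~R < X phi / (d / 2) := ceilB1_lt _.
rewrite intrB ltr_pdivlMr// mulrBl mulrDl !mul1r.
by move: (j%:~R * (d / 2)) => v; lra.
Qed.

End Cover.

(** * Simons' inequality and minorants coming from the space *)

(** Simons' inequality for the maximum [g] of a family [P] of continuous
affine functions. The weights are [w n = 2 ^ (- n)]. Points [y n] of [C n] are
chosen inductively such that [y n] almost minimises [g (partial n + w n *: y)]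
over [C n], where [partial n = w 1 *: y 0 + ... + w n *: y (n - 1)]. With
[z n] the average of the tail starting at [y n], one has
[z 0 = partial n + w n *: z n] and [z n] belongs to [C n], so that [y n] does
almost as well as [z n]. Let [phi - c] reach the maximum [g] at [z 0]: it is
nearly no larger at [y n] than at [z n], hence nearly no smaller at [z n.+1]
than at [z n]. *)
Section Simons.
Context {R : realType} {E : completeNormedModType R}.
Variables (P : set (dual E * R)) (g : E -> R).
Hypothesis Pg : forall phi c x, P (phi, c) -> phi x - c <= g x.
Hypothesis gP : forall x, exists2 z, P z & g x = z.1 x - z.2.
Variables (C : nat -> set E) (r m e : R).
Hypotheses (C0 : forall n, C n !=set0) (C_S : forall n, C n.+1 `<=` C n)
  (cC : forall n, convex_subset (C n)) (clC : forall n, closed (C n))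
  (Cr : forall x, C 0%N x -> `|x| <= r) (Cm : forall x, C 0%N x -> m <= g x)
  (e0 : 0 < e).

Let C_0 n : C n `<=` C 0%N.
Proof. by elim: n => [|n IH] x //= /C_S/IH. Qed.

Let w n : R := 2^-1 ^+ n.

Let w0 n : 0 < w n.
Proof. by rewrite exprn_gt0// invr_gt0. Qed.

Let wS n : w n.+1 = w n / 2.
Proof. by rewrite /w exprSr. Qed.

Let near_min v n : exists2 y, C n y &
  forall z, C n z -> g (v + w n *: y) <= g (v + w n *: z) + w n * (w n * e / 2).
Proof.
have [[phi c] Pphi _] := gP 0.
pose S := [set g (v + w n *: y) | y in C n].
have lbS : has_lbound S.
  exists (- (`|phi| * (`|v| + w n * r)) - c) => _ [y Cy <-].
  apply: le_trans (Pg _ Pphi); rewrite lerD2r lerNl.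
  apply: le_trans (ler_norm _) _; rewrite normrN.
  apply: le_trans (dual_bound _ _) _; rewrite ler_wpM2l//.
  apply: le_trans (ler_normD _ _) _; rewrite lerD2l normrZ gtr0_norm//.
  by rewrite ler_wpM2l ?(ltW (w0 n))// Cr//; exact: C_0 Cy.
have infS : has_inf S by split=> //; have [y Cy] := C0 n; exists (g (v + w n *: y)); exists y.
have q0 : 0 < w n * (w n * e / 2) by rewrite mulr_gt0// divr_gt0// mulr_gt0.
have [_ [y Cy <-] ylt] := inf_adherent q0 infS.
exists y => // z Cz; apply: le_trans (ltW ylt) _; rewrite lerD2r.
by apply: ge_inf => //; exists z.
Qed.

Let near_minimizers n v : set E := [set y | C n y /\
  forall z, C n z -> g (v + w n *: y) <= g (v + w n *: z) + w n * (w n * e / 2)].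

Let pick n v : E := get (near_minimizers n v).

Let pickP n v : near_minimizers n v (pick n v).
Proof. by apply: getPex; have [y ? ?] := near_min v n; exists y. Qed.

Let partial := fix v n : E :=
  if n isn't k.+1 then 0 else v k + w k.+1 *: pick k (v k).

Let y n := pick n (partial n).

(** The tail average [z n] is the limit of these finite convex combinations of
[y n], ..., [y (n + k)]; halving from the front keeps them in [C n]. *)
Fixpoint average (y : nat -> E) n k : E :=
  if k isn't j.+1 then y n else 2^-1 *: (y n + average y n.+1 j).

Let u := average y.

Let Cy n : C n (y n). Proof. by case: (pickP n (partial n)). Qed.

Let mid n a b : C n a -> C n b -> C n (2^-1 *: (a + b)).
Proof.
move=> Ca Cb; have h : 0 <= (2^-1 : R) <= 1 by apply/andP; split; lra.
have half : 1 - 2^-1 = 2^-1 :> R by lra.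
by have := cC Ca Cb h; rewrite half -scalerDr.
Qed.

Let Cu n k : C n (u n k).
Proof. by elim: k n => [n|k IH n]; [exact: Cy|apply: mid; [exact: Cy|exact: C_S]]. Qed.

Let u_cauchy k n j : `|u n k - u n (k + j)%N| <= 2 * r * w k.
Proof.
elim: k n => [n|k IH n].
  rewrite /w expr0 mulr1; apply: le_trans (ler_normB _ _) _.
  by have := Cr (C_0 (Cu n 0)); have := Cr (C_0 (Cu n (0 + j))); lra.
rewrite addSn /u/= -/u -scalerBr opprD addrACA subrr add0r normrZ.
rewrite ger0_norm ?invr_ge0// mulrC wS mulrA ler_wpM2r ?invr_ge0//.
Qed.

Let u_cvg n : cvgn (u n).
Proof.
apply/cauchy_cvgP/cauchy_exP => d d0.
have : w k @[k --> \oo] --> 0.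
  by apply: cvg_expr; rewrite ger0_norm ?invr_ge0// invf_lt1// ltr1n.
move=> /cvgrPdist_lt/(_ (d / (2 * `|r| + 1))).
have r1 : 0 < 2 * `|r| + 1 by rewrite ltr_wpDl// mulr_ge0.
move=> /(_ (divr_gt0 d0 r1))[K _ /(_ K (leqnn _))/=].
rewrite sub0r normrN gtr0_norm// ltr_pdivlMr// => wK.
exists (u n K), K => // k /= Kk; rewrite -ball_normE/=.
rewrite -(subnKC Kk); apply: le_lt_trans (u_cauchy _ _ _) _.
apply: le_lt_trans wK; rewrite mulrC ler_wpM2l ?(ltW (w0 K))//.
by have := ler_norm r; lra.
Qed.

Let z n := limn (u n).

Let Cz n : C n (z n).
Proof.
have Cu_near : \forall k \near \oo, C n (u n k) by apply: nearW => k; exact: Cu.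
exact: (closed_cvg (C n) (@clC n) Cu_near _ (@u_cvg n)).
Qed.

Let zE n : z n = 2^-1 *: (y n + z n.+1).
Proof.
have c1 : u n k.+1 @[k --> \oo] --> z n by rewrite cvg_shiftS; exact: u_cvg.
apply: (cvg_unique (@norm_hausdorff _ E) c1).
by apply: cvgZr; apply: cvgD; [exact: cvg_cst|exact: u_cvg].
Qed.

Let zv n : z 0%N = partial n + w n *: z n.
Proof.
elim: n => [|n ->]; first by rewrite /w expr0 scale1r add0r.
rewrite [partial n.+1]/= -/(y n) [in LHS]zE -addrA -scalerDr; congr (_ + _).
by rewrite scalerA -wS.
Qed.

Lemma simons : exists2 p, P p &
  exists z, forall n, C n (z n) /\ m - e <= p.1 (z n) - p.2.
Proof.
have [[phi c] Pphi gz] := gP (z 0%N); rewrite /= in gz.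
exists (phi, c) => //; exists z => n; split=> //=.
(* the error spent before stage n is e * (1 - w n) *)
suff : m - e + e * w n <= phi (z n) - c.
  by apply: le_trans; rewrite lerDl mulr_ge0 ?ltW.
elim: n => [|n IH].
  by rewrite /w expr0 mulr1 subrK -gz; exact: Cm.
have [_ /(_ _ (Cz n))] := pickP n (partial n).
rewrite -/(y n) -(zv n) gz {1}(zv n) => h.
have := le_trans (Pg _ Pphi) h; rewrite !linearD !linearZ/= /GRing.scale/= => h1.
have h2 : phi (y n) <= phi (z n) + w n * e / 2.
  by rewrite -(ler_pM2l (w0 n)) mulrDr; move: h1; lra.
have : phi (z n) = 2^-1 * (phi (y n) + phi (z n.+1)).
  by rewrite {1}zE linearZ linearD.
by rewrite wS; move: IH h2; lra.
Qed.

End Simons.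

Section Key.
Context {R : realType} {E : completeNormedModType R}.
Hypotheses (no_ell1 : ~ contains_copy_of (ell1 R) E) (sepE : separable E).
Variables (P : set (dual E * R)) (g : E -> R).
Hypothesis Pg : forall phi c x, P (phi, c) -> phi x - c <= g x.
Hypothesis gP : forall x, exists2 z, P z & g x = z.1 x - z.2.

(** If no [x] is suitable, then [g] is large on [D]. Let [C n] be the points
of [D] that are almost below [X] on the first [n] sets of a countable cover.
By repeated one-sided approximation [X] remains in the closure of [C n], so
[C n] is not empty. Simons' inequality gives a pair [(phi, c)] in [P] such
that [C n] contains, for every [n], points [z n] at which [phi - c] is large.
But [phi] belongs to some set of the cover, so that for [n] large [phi (z n)]
is at most [X phi] up to a small error, and [X phi - c] is not large. *)
Lemma predual_affine_minorant (X : dual (dual E)) (c0 : R) (phi0 : dual E) (e : R) :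
  (forall phi c, P (phi, c) -> X phi + c0 <= c) -> 0 < e ->
  exists x, X phi0 + c0 - e <= phi0 x - g x.
Proof.
move=> Xc e0; apply: contrapT => nox.
have gx x : phi0 x - g x < X phi0 + c0 - e.
  by rewrite ltNge; apply/negP => h; apply: nox; exists x.
have e8 : 0 < e / 8 by rewrite divr_gt0.
have [F [al [rho [FP Fcover]]]] := countable_cover no_ell1 sepE X e8.
pose D : set E := [set x | `|x| <= `|X| /\ `|phi0 x - X phi0| <= e / 2].
pose H n : set E := [set y | forall phi : dual E, F n phi -> phi y <= al n + e / 8].
pose C := fix C n : set E := if n isn't k.+1 then D else C k `&` H k.
have cH n : convex_subset (H n).
  move=> x y t Hx Hy /andP[t0 t1] phi Fphi; rewrite linearD !linearZ/= /GRing.scale/=.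
  have := ler_wpM2l t0 (Hx _ Fphi).
  have : (1 - t) * phi y <= (1 - t) * (al n + e / 8) by rewrite ler_wpM2l ?subr_ge0// Hy.
  by lra.
have cnorm (V : normedModType R) (x y a : V) t s : 0 <= t <= 1 -> `|x - a| <= s ->
    `|y - a| <= s -> `|t *: x + (1 - t) *: y - a| <= s.
  move=> /andP[t0 t1] xs ys.
  have -> : t *: x + (1 - t) *: y - a = t *: (x - a) + (1 - t) *: (y - a).
    by rewrite !scalerBr addrACA -opprD -scalerDl subrKC scale1r.
  apply: le_trans (ler_normD _ _) _; rewrite !normrZ !ger0_norm ?subr_ge0//.
  have := ler_wpM2l t0 xs.
  have : (1 - t) * `|y - a| <= (1 - t) * s by rewrite ler_wpM2l ?subr_ge0.
  by lra.
have cC n : convex_subset (C n).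
  elim: n => [|n IH] x y t /=; last first.
    by move=> [Cx Hx] [Cy Hy] t01; split; [exact: IH|exact: cH].
  move=> [xr x0] [yr y0] t01; split.
    by have := cnorm E x y 0 t `|X| t01; rewrite !subr0; apply.
  rewrite linearD !linearZ; exact: (cnorm R^o).
have closed_eval (phi : dual E) c : closed [set x | phi x <= c].
  by apply: (closed_comp _ (@closed_le _ c)) => x _; exact: dual_continuous.
have clC n : closed (C n).
  elim: n => [|n IH] /=.
    rewrite (_ : D = [set x | `|x| <= `|X|] `&` ([set x | phi0 x <= X phi0 + e / 2] `&`
        [set x | (- phi0) x <= - (X phi0 - e / 2)])).
      apply: closedI; last by apply: closedI; exact: closed_eval.
      by apply: (closed_comp _ (@closed_le _ `|X|)) => x _; exact: norm_continuous.
    apply/seteqP; split=> x.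
      move=> [h]; rewrite ler_norml => /andP[h1 h2]; split=> //; split=> /=; first by lra.
      by rewrite lerN2; lra.
    move=> [h /= [h1]]; rewrite lerN2 => h2; split=> //.
    by rewrite ler_norml; apply/andP; split; lra.
  apply: closedI => //.
  rewrite (_ : H n = \bigcap_(phi in (F n : set (dual E))) [set y | phi y <= al n + e / 8]).
    by apply: closed_bigI => phi _; exact: closed_eval.
  by apply/seteqP; split=> y h phi Fphi; exact: h.
have C_sub n : C n `<=` D by elim: n => [|n IH] x //= [/IH].
have aC n : bidual_adherent X (C n).
  elim: n => [Q s s0|n IH Q s s0].
    have se : 0 < Num.min s (e / 2) by rewrite lt_min s0 divr_gt0.
    have [x xX xP] := goldstine (phi0 :: Q) (lexx `|X|) se.
    exists x; first split=> //.
      have := xP phi0 (mem_head _ _); rewrite lt_min => /andP[_ h].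
      exact: ltW.
    move=> phi phiQ; have := xP phi; rewrite inE phiQ orbT lt_min.
    by move=> /(_ isT)/andP[].
  have [clF Frho FX] := FP n.
  (* the constraints of Q are imposed beforehand, with a margin, so that the
     point found by separation satisfies them too *)
  pose C' := C n `&` [set x | forall phi, phi \in Q -> `|phi x - X phi| <= s / 2].
  have s2 : 0 < s / 2 by rewrite divr_gt0.
  have [|||||||y [Cy yQ] yF] :=
    @haydon_separation _ _ X C' (F n) `|X| (rho n) (al n) (e / 8) no_ell1.
  - move=> x y t [Cx Qx] [Cy Qy] t01; split; first exact: cC.
    move=> phi phiQ; rewrite linearD !linearZ; apply: (cnorm R^o) => //.
      exact: Qx.
    exact: Qy.
  - by move=> x [/C_sub[]].
  - move=> Q' s' s'0; have ss : 0 < Num.min s' (s / 2) by rewrite lt_min s'0.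
    have [x Cx xQ] := IH (Q ++ Q') _ ss.
    exists x; first split=> //.
      move=> phi phiQ; have := xQ phi; rewrite mem_cat phiQ lt_min => /(_ isT)/andP[_ h].
      exact: ltW.
    move=> phi phiQ; have := xQ phi; rewrite mem_cat phiQ orbT lt_min.
    by move=> /(_ isT)/andP[].
  - exact: clF.
  - exact: Frho.
  - exact: FX.
  - exact: e8.
  exists y; first by split.
  by move=> phi phiQ; apply: le_lt_trans (yQ _ phiQ) _; lra.
have gD x : D x -> e / 2 - c0 <= g x.
  by move=> [_]; rewrite ler_norml => /andP[h1 _]; have := gx x; lra.
have Cn0 n : C n !=set0 by have [x Cx _] := aC n [::] _ ltr01; exists x.
have C_S n : C n.+1 `<=` C n by move=> x [].
have [[phi c] Pphi [z zP]] :=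
  simons Pg gP Cn0 C_S cC clC (fun x (Dx : D x) => Dx.1) gD e8.
have [n Fphi aln] := Fcover phi.
have [[_ /(_ _ Fphi) h1] /= h2] := zP n.+1.
by have := Xc _ _ Pphi; move: h1 h2 aln; lra.
Qed.

End Key.

(** * Weak* lower semicontinuity and compactness *)

Lemma pointwise_bounded_dual (R : realType) (E : completeNormedModType R)
    (S : set (dual E)) :
  (forall x, exists M, forall phi, S phi -> `|phi x| <= M) ->
  exists rho, forall phi, S phi -> `|phi| <= rho.
Proof.
move=> ptS.
pose F : set (E -> R^o) := [set f | exists2 phi, S phi & f = phi :> (E -> R)].
have FE f : F f -> bounded_fun_norm f /\ linear f.
  move=> [phi _ ->]; split; last exact: dual_linear.
  move=> s; exists (`|phi| * `|s|) => x xs.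
  by apply: le_trans (dual_bound _ _) _; rewrite ler_wpM2l// (le_trans xs)// ler_norm.
have [|rho rhoP] := Banach_Steinhauss FE _ 1.
  by move=> x; have [M MP] := ptS x; exists M => _ [phi Sphi ->]; exact: MP.
exists rho => phi Sphi; apply: dual_norm_le => x x1.
by apply: (rhoP phi) => //; exists phi.
Qed.

Theorem theorem14 (R : realType) (E : completeNormedModType R)
    (sepE : separable E)
    (no_ell1 : ~ contains_copy_of (ell1 R) E)
    (f : dual E -> \bar R)
    (f_ninfty : forall phi, f phi != -oo%E)
    (f_lsc : lower_semicontinuous f)
    (f_convex : convex_efun f)
    (f_proper : exists phi, f phi != +oo%E)
    (f_sup : forall x : E,
       attains_sup (fun phi : dual E => (phi x)%:E - f phi)%E) :
  @lower_semicontinuous (weak_star E) R f /\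
  forall mu : R, @compact (weak_star E) [set phi | (f phi <= mu%:E)%E].
Proof.
(* the pairs (phi, c) with c = f phi finite stand for the affine functions
   x |-> phi x - f phi on E *)
pose P : set (dual E * R) := [set z | f z.1 = z.2%:E].
have fin phi : f phi != +oo%E -> P (phi, fine (f phi)).
  by move=> fphi; rewrite /P/= fineK// fin_numE f_ninfty.
have /choice[g gE] : forall x, exists gx, (exists2 z, P z & gx = z.1 x - z.2) /\
    forall z, P z -> z.1 x - z.2 <= gx.
  move=> x; have [phi supE] := f_sup x.
  have le_phi z : P z -> ((z.1 x - z.2)%:E <= (phi x)%:E - f phi)%E.
    by move=> Pz; rewrite supE EFinB -Pz; apply: ereal_sup_ubound; exists z.1.
  have [phi1 /fin/le_phi le1] := f_proper.
  have fphi : f phi != +oo%E.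
    by apply/eqP => foo; move: le1; rewrite foo leeNy_eq.
  exists (phi x - fine (f phi)); split; first by exists (phi, fine (f phi)) => //; exact: fin.
  have phiE : f phi = (fine (f phi))%:E := fin _ fphi.
  by move=> z /le_phi; rewrite phiE -EFinB lee_fin.
have Pg (phi : dual E) c x : P (phi, c) -> phi x - c <= g x by move=> /((gE x).2 (phi, c)).
have gP x : exists2 z, P z & g x = z.1 x - z.2 by case: (gE x).
have f_ge x (phi : dual E) : ((phi x - g x)%:E <= f phi)%E.
  have [->|/fin fphi] := eqVneq (f phi) +oo%E; first exact: leey.
  by have := Pg _ _ x fphi; rewrite fphi lee_fin /=; lra.
have f_lb phi : ((- g 0)%:E <= f phi)%E.
  by have := f_ge 0 phi; rewrite linear0 sub0r.
have lsc : @lower_semicontinuous (weak_star E) R f.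
  move=> phi0 t tf.
  have [t' tt' t'f] : exists2 t', t < t' & (t'%:E < f phi0)%E.
    have [->|/fin fphi] := eqVneq (f phi0) +oo%E.
      by exists (t + 1); rewrite ?ltrDl// ltry.
    move: tf; rewrite fphi /= lte_fin => tf.
    by exists ((t + fine (f phi0)) / 2); rewrite ?lte_fin; lra.
  have [X [c [Xf Xphi0]]] := affine_minorant f_lsc f_convex f_lb f_proper t'f.
  have XP phi b : P (phi, b) -> X phi + c <= b.
    by move=> Pb; have := Xf phi; rewrite Pb lee_fin.
  have e0 : 0 < (t' - t) / 2 by rewrite divr_gt0// subr_gt0.
  have [x xP] := predual_affine_minorant no_ell1 sepE Pg gP phi0 XP e0.
  exists [set phi : weak_star E | t + g x < (phi : dual E) x].
    by apply: open_nbhs_nbhs; split; [exact: weak_star_open_gt|rewrite /=; lra].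
  move=> phi /= h; apply: lt_le_trans (f_ge x phi).
  by rewrite lte_fin; lra.
split=> // mu.
have [rho rhoP] : exists rho, forall phi, (f phi <= mu%:E)%E -> `|phi| <= rho.
  apply: (@pointwise_bounded_dual _ _ [set phi | (f phi <= mu%:E)%E]) => x.
  exists (`|g x| + `|g (- x)| + mu) => phi /= fmu.
  have := le_trans (f_ge x phi) fmu; have := le_trans (f_ge (- x) phi) fmu.
  rewrite !lee_fin linearN ler_norml => h1 h2.
  have := ler_norm (g x); have := ler_norm (g (- x)).
  have := normr_ge0 (g x); have := normr_ge0 (g (- x)).
  by move=> *; apply/andP; split; lra.
apply: (@subclosed_compact _ _ (dual_ball rho)) => //; last exact: banach_alaoglu.
rewrite (_ : [set phi | _] = ~` [set phi : weak_star E | (mu%:E < f phi)%E]).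
  by apply: open_closedC; move/lower_semicontinuousP : lsc; exact.
by apply/seteqP; split=> phi /=; rewrite leNgt => /negP.
Qed.
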